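(* Let $B$ be a Polish metric space and let $\mathcal{X}$ and $\mathcal{Y}$ be bounded $mm$-fields over $B$. Then, for any $1\le p\le\infty$, $$\lim_{n\to\infty}d_{W,p}(\mathcal{D}^n_{\mathcal{X}},\mathcal{D}^n_{\mathcal{Y}})=d_{W,p}(\mathcal{D}_{\mathcal{X}},\mathcal{D}_{\mathcal{Y}})=d_{GW,\infty}(\mathcal{X},\mathcal{Y}).$$
   Context: A Polish metric space is a complete separable metric space. An $mm$-field over a Polish metric space $(B,d_B)$ is a quadruple $\mathcal{X}=(X,d_X,\pi_X,\mu_X)$, where $(X,d_X)$ is a Polish metric space, $\pi_X\colon X\to B$ is 1-Lipschitz and $\mu_X$ is a Borel probability measure on $X$. It is bounded if $(X,d_X)$ has finite diameter. $C(\mu,\nu)$ denotes the set of couplings (Borel probability measures on the product with marginals $\mu,\nu$). Put $m_{X,Y}(x,y,x',y')=|d_X(x,x')-d_Y(y,y')|$ and $d_{X,Y}(x,y)=d_B(\pi_X(x),\pi_Y(y))$, and $$d_{GW,\infty}(\mathcal{X},\mathcal{Y}):=\inf_{\mu\in C(\mu_X,\mu_Y)}\max\Big\{\frac12\sup_{\mathrm{supp}(\mu\otimes\mu)}m_{X,Y},\ \sup_{\mathrm{supp}\,\mu}d_{X,Y}\Big\}.$$ Let $\mathcal{R}^n=\{(r_{ij})\in\mathbb{R}^{n\times n}: r_{ij}=r_{ji},\ r_{ii}=0,\ r_{ik}\le r_{ij}+r_{jk}\}$ and let $\mathcal{R}\subset\mathbb{R}^{\mathbb{N}\times\mathbb{N}}$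 be defined by the same conditions with indices in $\mathbb{N}$, equipped with the weak topology (the coarsest making all projections $\mathcal{R}\to\mathcal{R}^n$ onto the northwest $n\times n$ block continuous). Set $\mathcal{R}_B=\mathcal{R}\times B^\infty$ and $\mathcal{R}_B^n=\mathcal{R}^n\times B^n$ (product topologies). Define the metric $\rho_n$ on $\mathcal{R}_B^n$ and the extended metric $\rho$ on $\mathcal{R}_B$ by $$\max\Big(\frac12\sup_{i,j}|r_{ij}-r'_{ij}|,\ \sup_i d_B(b_i,b'_i)\Big)$$ for pairs $((r_{ij}),(b_i))$, $((r'_{ij}),(b'_i))$, with indices ranging over $\{1,\dots,n\}$ and over $\mathbb{N}$ respectively. The augmented distance matrix distribution of $\mathcal{X}$ is the Borel probability measure $\mathcal{D}_{\mathcal{X}}=(\mathcal{F}_{\mathcal{X}})_*(\mu_X^\infty)$ on $\mathcal{R}_B$, where $\mathcal{F}_{\mathcal{X}}\colon X^\infty\to\mathcal{R}_B$, $(x_i)\mapsto((d_X(x_i,x_j))_{ij},(\pi_X(x_i))_i)$. Similarly $\mathcal{D}^n_{\mathcal{X}}=(\mathcal{F}^n_{\mathcal{X}})_*(\mu_X^n)$ on $\mathcal{R}^n_B$, where $\mathcal{F}^n_{\mathcal{X}}\colon X^n\to\mathcal{R}^n_B$ is given by the same formula for $n$-tuples. The $p$-Wasserstein distance $d_{W,p}(\mathcal{D}_{\mathcal{X}},\mathcal{D}_{\mathcal{Y}})$ is taken with respect to $\rho$: it is $\inf_{\nu\in C(\mathcal{D}_{\mathcal{X}},\mathcal{D}_{\mathcal{Y}})}(\int\rho^p\,d\nu)^{1/p}$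 for $p<\infty$, and $\inf_\nu\sup_{\mathrm{supp}\,\nu}\rho$ for $p=\infty$. The distance $d_{W,p}(\mathcal{D}^n_{\mathcal{X}},\mathcal{D}^n_{\mathcal{Y}})$ is defined in the same way with respect to $\rho_n$. The Borel structure on $\mathcal{R}_B$ is that of the product (weak) topology, not of $\rho$. *)

(* Defs.v *)
From HB Require Import structures.
From mathcomp Require Import all_boot all_order all_algebra.
From mathcomp Require Import all_classical all_reals all_analysis.
From mathcomp Require Import lra.

Set Implicit Arguments.
Unset Strict Implicit.
Unset Printing Implicit Defensive.

Import Order.TTheory GRing.Theory Num.Theory.
Import numFieldNormedType.Exports.

Local Open Scope classical_set_scope.
Local Open Scope ring_scope.

HB.mixin Record isSeparable T & Topological T := {
  separable : exists2 D : set T, countable D & dense D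
}.

(* [Complete] brings in [Pointed]: spaces are nonempty, as is forced by the
   presence of a probability measure. *)
#[short(type="polishMetricType")]
HB.structure Definition PolishMetric (R : numDomainType) :=
  {T of Metric R T & Complete T & isSeparable T}.

HB.instance Definition _ (S T : ptopologicalType) := Pointed.on (S * T)%type.
HB.instance Definition _ (I : Type) (T : I -> ptopologicalType) :=
  Pointed.on (prod_topology T).

Notation borel T := (g_sigma_algebraType (@open T)).

Lemma continuous_borel_measurable (S T : ptopologicalType) (f : S -> T) :
  continuous f -> @measurable_fun _ _ (borel S) (borel T) setT f.
Proof.
move=> /continuousP cf.
apply: (@measurability _ _ (borel S) (borel T) setT f open) => //.
by move=> _ [U oU <-]; rewrite setTI; apply: sub_sigma_algebra; exact: cf.
Qed.

Definition supp (R : realType) (T : topologicalType) (mu : set T -> \bar R) :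
    set T :=
  [set x | forall U : set T, open U -> U x -> (0 < mu U)%E].

Definition coupling (R : realType) (S T : ptopologicalType)
    (mu : probability (borel S) R) (nu : probability (borel T) R) :
    set (probability (borel (S * T)%type) R) :=
  [set g | (forall A : set (borel S), measurable A ->
              g ((fst : S * T -> S) @^-1` A) = mu A) /\
           (forall B : set (borel T), measurable B ->
              g ((snd : S * T -> T) @^-1` B) = nu B)].

(* For countable [I] and second countable [T], the Borel sets of [T^I] are
   generated by the finite-dimensional cylinders, so this condition determines
   at most one Borel measure; it exists by Kolmogorov's theorem. *)
Definition is_product_law (R : realType) (I : countType) (T : ptopologicalType)
    (mu : probability (borel T) R) :
    set (probability (borel {ptws I -> T}) R) :=
  [set P | forall (s : seq I) (A : I -> set (borel T)),
     uniq s -> (forall i, measurable (A i)) ->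
     P [set x | forall i, i \in s -> A i (x i)] =
       (\big[mule/1]_(i <- s) mu (A i))%E].
Arguments is_product_law {R} I {T} mu.

Definition product_law (R : realType) (I : countType) (T : ptopologicalType)
    (mu : probability (borel T) R) : probability (borel {ptws I -> T}) R :=
  get (is_product_law I mu).
Arguments product_law {R} I {T} mu.

(* Meant for [1 <= p], so that the [else] branch is [p = +oo]. *)
Definition wasserstein (R : realType) (T : ptopologicalType)
    (rho : T -> T -> \bar R) (p : \bar R)
    (mu nu : probability (borel T) R) : \bar R :=
  ereal_inf [set
    (if p is q%:E then (\int[g]_z (rho z.1 z.2 `^ q)) `^ q^-1
     else ereal_sup [set rho z.1 z.2 | z in supp g])%E | g in coupling mu nu].

Record mm_field (R : realType) (B : polishMetricType R) := MMField {
  mm_space :> polishMetricType R ;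
  mm_proj : mm_space -> B ;
  mm_proj_lip : forall x y, mdist (mm_proj x) (mm_proj y) <= mdist x y ;
  mm_meas : probability (borel mm_space) R }.

Definition mm_bounded (R : realType) (B : polishMetricType R)
    (X : mm_field B) : Prop :=
  exists M : R, forall x y : X, mdist x y <= M.

Definition dGW_infty (R : realType) (B : polishMetricType R)
    (X Y : mm_field B) : \bar R :=
  ereal_inf [set
    maxe (2^-1%:E * ereal_sup
           [set `|mdist z.1.1 z.2.1 - mdist z.1.2 z.2.2|%:E
              | z in supp (mu \x mu)%E : set ((X * Y) * (X * Y))])%E
         (ereal_sup [set (mdist (mm_proj z.1) (mm_proj z.2))%:E
              | z in supp mu : set (X * Y)])
  | mu in coupling (mm_meas X) (mm_meas Y)].

Definition pseudometrics (R : realType) (I : Type) :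
    set {ptws (I * I)%type -> R} :=
  [set r | [/\ forall i j, r (i, j) = r (j, i),
               forall i, r (i, i) = 0 &
               forall i j k, r (i, k) <= r (i, j) + r (j, k)]].

Lemma pseudometrics0 (R : realType) (I : Type) :
  (fun=> 0) \in @pseudometrics R I.
Proof. by rewrite inE; split => // i j k; rewrite addr0. Qed.

(* Subspace topology of the product; for [I = nat] this is the coarsest topology
   making the projections on all northwest blocks continuous, see
   [continuous_distmx_blockP]. *)
Definition distmx (R : realType) (I : Type) : Type := @pseudometrics R I.

HB.instance Definition _ (R : realType) (I : Type) :=
  Topological.copy (distmx R I) (set_type (@pseudometrics R I)).
HB.instance Definition _ (R : realType) (I : Type) :=
  isPointed.Build (distmx R I) (exist _ (fun=> 0) (pseudometrics0 R I)).


Lemma continuous_ptwsP (S : topologicalType) (I : Type) (T : topologicalType)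
    (f : S -> {ptws I -> T}) :
  continuous f <-> forall i, continuous (fun x => f x i).
Proof.
split=> [cf i x|cf x].
  have /cvg_sup/(_ i) cfx : f @ x --> f x by exact: cf.
  move=> U nU; apply: (cfx ((fun g : I -> T => g i) @^-1` U)).
  exact: (@initial_continuous _ _ (fun g : forall _ : I, T => g i) (f x) U nU).
apply/cvg_sup => i.
exact: (@continuous_comp_initial _ _ _ (fun g : forall _ : I, T => g i) f
  (cf i) x).
Qed.

Lemma continuous_distmxP (S : topologicalType) (R : realType) (I : Type)
    (f : S -> distmx R I) :
  continuous f <-> forall i j, continuous (fun x => set_val (f x) (i, j)).
Proof.
have cv : continuous (set_val : distmx R I -> {ptws (I * I)%type -> R}).
  exact: initial_continuous.
split=> [cf i j|cf].
  have : continuous (fun x => set_val (f x) : {ptws (I * I)%type -> R}).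
    by move=> x; apply: continuous_comp; [exact: cf|exact: cv].
  by move/continuous_ptwsP; exact.
apply: (@continuous_comp_initial _ _ _
  (set_val : distmx R I -> {ptws (I * I)%type -> R}) f).
by apply/continuous_ptwsP => -[i j]; exact: cf.
Qed.

Lemma distmx_block_subproof (R : realType) (n : nat) (r : distmx R nat) :
  (fun ij : 'I_n * 'I_n => set_val r (val ij.1, val ij.2))
    \in @pseudometrics R 'I_n.
Proof.
rewrite inE; have [rC r0 rD] : pseudometrics (set_val r) by exact: set_valP.
by split=> [i j|i|i j k] /=; [exact: rC|exact: r0|exact: rD].
Qed.

Definition distmx_block (R : realType) (n : nat) (r : distmx R nat) :
    distmx R 'I_n :=
  exist (fun d => d \in @pseudometrics R 'I_n) _ (distmx_block_subproof n r).

Lemma continuous_distmx_blockP (S : topologicalType) (R : realType)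
    (f : S -> distmx R nat) :
  continuous f <-> forall n, continuous (fun x => distmx_block n (f x)).
Proof.
split=> [/continuous_distmxP cf n|cf]; apply/continuous_distmxP => i j.
  exact: cf.
have /continuous_distmxP := cf (maxn i j).+1.
have im : (i < (maxn i j).+1)%N by rewrite ltnS leq_maxl.
have jm : (j < (maxn i j).+1)%N by rewrite ltnS leq_maxr.
by move=> /(_ (Ordinal im) (Ordinal jm)).
Qed.

Notation augmx R B I := (distmx R I * {ptws I -> B})%type.

(* The suprema are [-oo] when [I] is empty ([I = 'I_0]). *)
Definition augmx_dist (R : realType) (B : polishMetricType R) (I : Type)
    (u v : augmx R B I) : \bar R :=
  maxe (2^-1%:E * ereal_sup
          [set `|set_val u.1 ij - set_val v.1 ij|%:E | ij in [set: I * I]])%E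
       (ereal_sup [set (mdist (u.2 i) (v.2 i))%:E | i in [set: I]]).

Lemma mm_distmx_subproof (R : realType) (B : polishMetricType R)
    (X : mm_field B) (I : Type) (x : I -> X) :
  (fun ij : I * I => mdist (x ij.1) (x ij.2)) \in @pseudometrics R I.
Proof.
rewrite inE; split=> [i j|i|i j k] /=.
- exact: metric_sym.
- exact: mdistxx.
- exact: metric_triangle.
Qed.

Definition mm_distmx (R : realType) (B : polishMetricType R) (X : mm_field B)
    (I : Type) (x : {ptws I -> X}) : distmx R I :=
  exist (fun d => d \in @pseudometrics R I) _ (mm_distmx_subproof x).

Definition mm_augmx (R : realType) (B : polishMetricType R) (X : mm_field B)
    (I : Type) (x : {ptws I -> X}) : augmx R B I :=
  (mm_distmx x, fun i => mm_proj (x i)).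

Lemma continuous_mdist (R : realType) (X : metricType R) :
  continuous (fun z : X * X => mdist z.1 z.2 : R).
Proof.
move=> [x y] /=; apply/cvgrPdist_le => e e0.
have mdist_near (a : X) : nbhs a [set b | mdist a b < e / 2].
  by rewrite -metricType_numDomainType.filter_from_mdist_nbhs;
    exists (e / 2) => //=; rewrite divr_gt0.
exists ([set u | mdist x u < e / 2], [set v | mdist y v < e / 2]) => //.
move=> z /= [xz yz].
have := metric_triangle x z.1 y; have := metric_triangle z.1 z.2 y.
have := metric_triangle z.1 x z.2; have := metric_triangle x y z.2.
rewrite (metric_sym z.1 x) (metric_sym z.2 y) ler_norml => *.
by apply/andP; split; lra.
Qed.

Lemma continuous_pair (S T U : topologicalType) (f : S -> T) (g : S -> U) :
  continuous f -> continuous g -> continuous (fun x => (f x, g x)).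
Proof. by move=> cf cg x; apply: cvg_pair; [exact: cf|exact: cg]. Qed.

Lemma continuous_comp_fun (S T U : topologicalType) (f : S -> T) (g : T -> U) :
  continuous f -> continuous g -> continuous (fun x => g (f x)).
Proof. by move=> cf cg x; apply: continuous_comp; [exact: cf|exact: cg]. Qed.

Lemma continuous_mm_augmx (R : realType) (B : polishMetricType R)
    (X : mm_field B) (I : Type) : continuous (@mm_augmx R B X I).
Proof.
have cproj (i : I) : continuous (fun x : {ptws I -> X} => x i).
  have /continuous_ptwsP : continuous (fun x : {ptws I -> X} => x).
    by move=> x; exact: cvg_id.
  exact.
have c1 : continuous (@mm_distmx R B X I).
  apply/continuous_distmxP => i j.
  have cij := continuous_pair (cproj i) (cproj j).
  have cd := @continuous_mdist R X.
  by rewrite set_valE; exact: (continuous_comp_fun cij cd).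
have cpi : continuous (@mm_proj R B X).
  move=> x; apply/metricType_numDomainType.cvgrPdist_lt => e e0.
  have : nbhs x [set y | mdist x y < e].
    by rewrite -metricType_numDomainType.filter_from_mdist_nbhs; exists e.
  by apply: filterS => y; apply: le_lt_trans; exact: mm_proj_lip.
have c2 : continuous
    (fun x : {ptws I -> X} => (fun i => mm_proj (x i)) : {ptws I -> B}).
  apply/continuous_ptwsP => i x.
  exact: (continuous_comp_fun (cproj i) cpi).
exact: continuous_pair c1 c2.
Qed.

Lemma mm_augmx_mfun_subproof (R : realType) (B : polishMetricType R)
    (X : mm_field B) (I : Type) :
  @mm_augmx R B X I \in @mfun _ _ (borel {ptws I -> X}) (borel (augmx R B I)).
Proof.
apply: mem_set; apply: continuous_borel_measurable.
exact: continuous_mm_augmx.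
Qed.

Definition augmx_distribution (R : realType) (B : polishMetricType R)
    (X : mm_field B) (I : countType) : probability (borel (augmx R B I)) R :=
  distribution (product_law I (mm_meas X))
    (mfun_Sub (mm_augmx_mfun_subproof X I)).

(* Main.v *)
From HB Require Import structures.
Require Import Defs.
From mathcomp Require Import all_boot all_order all_algebra.
From mathcomp Require Import all_classical all_reals all_analysis.
From mathcomp Require Import measurable_realfun.
From mathcomp Require Import lra ring.

(**
  Let [W_I] be the Wasserstein distance of the augmented distance matrix
  distributions indexed by [I].

  [W_I <= dGW]: given a coupling [mu] of the measures of [X] and [Y], sample
  [I] independent pairs from [mu].  Almost surely all pairs lie in the support
  of [mu], so the two augmented distance matrices are at distance at most the
  cost of [mu].

  [dGW <= liminf W_n] and [dGW <= W_nat]: if [W_I < c < c'], Markov's inequality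
  gives a coupling of the matrix distributions under which the distance is at
  most [c'] with probability at least [1 - c / c'], a bound independent of [I].
  By the law of large numbers samples with good empirical frequencies have
  probability close to one when [n] is large; their images under the matrix map
  need not be Borel, but small neighbourhoods of these images are open.  Hence
  there are good samples of [X] and [Y] with matrices at distance almost at most
  [c'].  A limit of the empirical measures of the paired samples is a coupling of
  [X] and [Y] of cost at most [c'].

  Product laws and limits of empirical measures are both constructed through
  Borel codings of Polish spaces by sequences of bits: a consistent assignment of
  masses to finite words is realized by nested subintervals of [0, 1[.  No
  tightness is needed, because a coding only requires a measurable left inverse.
*)

Set Implicit Arguments.
Unset Strict Implicit.
Unset Printing Implicit Defensive.

Import Order.TTheory GRing.Theory Num.Theory.
Import numFieldNormedType.Exports.

Local Open Scope classical_set_scope.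
Local Open Scope ring_scope.

(** * Second countable spaces and their Borel sets *)

(** The function [augmx_dist] need not be continuous for the product topology that carries the Borel
    structure. As a supremum of continuous functions it has closed sublevel sets, and its
    measurability and all support arguments rest on these. The order of choices matters in the lower
    bound: [c < c'] are fixed first, and only then is n taken so large that each of the two sets of
    bad samples weighs less than [(1 - c / c') / 2]. The gap between [c] and [c'] is the price of
    Markov's inequality and disappears at the very end. Finite and infinite index sets are treated
    together through an injection [iota : 'I_n -> I]. Empirical measures are followed along an
    ultrafilter, so that every set of pairs, measurable or not, has a limit frequency at once. The
    limit is only finitely additive; countable additivity is regained on bit sequences, where any
    consistent masses of cylinders come from a measure. Second countability is carried along because
    it makes rectangles generate the Borel sets of a product and makes the complement of a support
    null. *)

Definition base_seq (T : topologicalType) (B : nat -> set T) :=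
  (forall n, open (B n)) /\
  (forall x U, open U -> U x -> exists n, B n x /\ B n `<=` U).

Lemma base_seq_second_countable (T : topologicalType) (B : nat -> set T) :
  base_seq B -> @second_countable T.
Proof.
move=> [Bo Bb]; exists (range B).
  by apply: card_le_trans (card_image_le _ _) _; exact: countableP.
split=> [_ [n _ <-]//|x U]; rewrite nbhsE => -[V [Vo Vx] VU].
have [n [Bx BV]] := Bb _ _ Vo Vx.
by exists (B n) => /=; [split=> //; exists n|exact: subset_trans BV VU].
Qed.

Lemma second_countableP (T : topologicalType) :
  @second_countable T <-> exists B : nat -> set T, base_seq B.
Proof.
split=> [[F cF [Fo Fb]]|[B]]; last exact: base_seq_second_countable.
have [f [fo fF]] : exists f : nat -> set T, (forall n, open (f n)) /\ F `<=` range f.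
  have /pfcard_geP[F0|[f]] := cF.
    by exists (fun=> set0); split=> [_|]; [exact: open0|rewrite F0].
  exists f; split=> [n|]; last exact: surj.
  by apply/Fo; exact: funS.
exists f; split=> // x U oU Ux.
have [V [FV Vx] VU] := Fb x U (open_nbhs_nbhs (conj oU Ux)).
by have [n _ nV] := fF _ FV; exists n; rewrite nV.
Qed.

Lemma open_borel (T : ptopologicalType) (U : set T) :
  open U -> measurable (U : set (borel T)).
Proof. exact: sub_sigma_algebra. Qed.

Lemma closed_borel (T : ptopologicalType) (F : set T) :
  closed F -> measurable (F : set (borel T)).
Proof.
move=> cF; rewrite -[F]setCK; apply: measurableC.
by apply: open_borel; exact: closed_openC.
Qed.

Lemma openX (S T : topologicalType) (U : set S) (V : set T) :
  open U -> open V -> open (U `*` V).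
Proof.
rewrite !openE => oU oV [x y] [/= Ux Vy].
by exists (U, V) => //=; split; [exact: oU|exact: oV].
Qed.

Lemma open_prod_nbhs (S T : topologicalType) (U : set (S * T)) x y :
  open U -> U (x, y) -> exists V W,
    [/\ open V, V x, open W, W y & V `*` W `<=` U].
Proof.
rewrite openE => /[apply] -[[V W]] /= [].
rewrite !nbhsE => -[V' [V'o V'x] V'V] [W' [W'o W'y] W'W] VWU.
exists V', W'; split=> // -[a b] [/= /V'V Va /W'W Wb].
exact: VWU.
Qed.

Lemma second_countable_prod (S T : topologicalType) :
  @second_countable S -> @second_countable T -> @second_countable (S * T)%type.
Proof.
move=> /second_countableP[A [Ao Ab]] /second_countableP[B [Bo Bb]].
pose d k : nat * nat := odflt (0, 0)%N (unpickle k).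
apply: (@base_seq_second_countable _ (fun k => A (d k).1 `*` B (d k).2)).
split=> [n|[x y] U oU Uxy]; first exact: openX.
have [V [W [Vo Vx Wo Wy VWU]]] := open_prod_nbhs oU Uxy.
have [i [Ai iV]] := Ab _ _ Vo Vx; have [j [Bj jW]] := Bb _ _ Wo Wy.
exists (pickle (i, j)); rewrite /d pickleK/=; split=> //.
by move=> [a b] [/= /iV Va /jW Wb]; apply: VWU.
Qed.

Lemma second_countable_initial (S : choiceType) (T : topologicalType)
    (f : S -> T) :
  @second_countable T -> @second_countable (initial_topology f).
Proof.
move=> /second_countableP[B [Bo Bb]].
apply: (@base_seq_second_countable (initial_topology f)
  (fun n => f @^-1` B n)); split.
  by move=> n; exists (B n).
move=> x _ [V oV <-] /= Vx; have [n [Bx BV]] := Bb _ _ oV Vx.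
by exists n; split=> // y /BV.
Qed.

Lemma ptws_eval_open (I : Type) (T : topologicalType) (i : I) (U : set T) :
  open U -> open [set x : {ptws I -> T} | U (x i)].
Proof.
have /continuous_ptwsP/(_ i)/continuousP c :
    continuous (fun x : {ptws I -> T} => x) by move=> x; exact: cvg_id.
exact: c.
Qed.

(** A list of pairs (coordinate, index of a basic set), with repetitions allowed: such lists are
    countable, and concatenation is intersection. *)
Definition ptws_cylinder (I : eqType) (T : Type) (B : nat -> set T)
    (l : seq (I * nat)) : set (I -> T) :=
  [set x | forall p, p \in l -> B p.2 (x p.1)].

Lemma ptws_cylinder_cat (I : eqType) (T : Type) (B : nat -> set T)
    (l l' : seq (I * nat)) :
  ptws_cylinder B (l ++ l') = ptws_cylinder B l `&` ptws_cylinder B l'.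
Proof.
apply/seteqP; split=> [x xl|x [xl xl'] p].
  by split=> p pl; apply: xl; rewrite mem_cat pl ?orbT.
by rewrite mem_cat => /orP[]; [exact: xl|exact: xl'].
Qed.

Lemma ptws_cylinder_cons (I : eqType) (T : Type) (B : nat -> set T)
    (i : I) n l :
  ptws_cylinder B ((i, n) :: l) =
  [set x | B n (x i)] `&` ptws_cylinder B l.
Proof.
rewrite -cat1s ptws_cylinder_cat; congr (_ `&` _).
apply/seteqP; split=> [x /(_ (i, n))|x Bx p]; first by apply; rewrite inE.
by rewrite inE => /eqP ->.
Qed.

Lemma ptws_cylinder_open (I : eqType) (T : topologicalType) (B : nat -> set T)
    l : base_seq B -> open (ptws_cylinder B l : set {ptws I -> T}).
Proof.
move=> [Bo _]; elim: l => [|[i n] l IH].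
  by rewrite (_ : ptws_cylinder _ _ = setT); [exact: openT|exact/seteqP].
rewrite ptws_cylinder_cons; apply: openI => //.
exact: ptws_eval_open.
Qed.

(** The cylinders through [x] form a filter base, closed under intersection by concatenation. This
    filter converges to [x] in each coordinate, hence in the product topology, so it contains
    [U]. *)
Lemma ptws_cylinder_base (I : eqType) (T : topologicalType) (B : nat -> set T)
    (U : set {ptws I -> T}) (x : {ptws I -> T}) : base_seq B -> open U -> U x ->
  exists l, ptws_cylinder B l x /\ ptws_cylinder B l `<=` U.
Proof.
move=> [_ Bb] oU Ux.
pose F := filter_from [set l | ptws_cylinder B l x] (ptws_cylinder B).
suff [l lx lU] : F U by exists l.
have FF : Filter F.
  apply: filter_from_filter; first by exists [::].
  by move=> l l' lx lx'; exists (l ++ l'); rewrite /= ptws_cylinder_cat.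
suff Fx : F --> x by apply: Fx; exact: open_nbhs_nbhs.
apply/cvg_sup => i V [_ [[W oW <-]] /= Wx WV].
have [n [Bn nW]] := Bb _ _ oW Wx.
exists [:: (i, n)] => /=; first by move=> p; rewrite inE => /eqP ->.
by move=> y /(_ (i, n)); rewrite inE eqxx => /(_ isT)/= /nW yW; exact: WV.
Qed.

Lemma second_countable_ptws (I : countType) (T : topologicalType) :
  @second_countable T -> @second_countable {ptws I -> T}.
Proof.
move=> /second_countableP[B bB].
apply: (@base_seq_second_countable {ptws I -> T}
  (fun n => ptws_cylinder B (odflt [::] (unpickle n)))); split.
  by move=> n; exact: ptws_cylinder_open.
move=> x U oU Ux; have [l [lx lU]] := ptws_cylinder_base bB oU Ux.
by exists (pickle l); rewrite pickleK.
Qed.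

Lemma bigcup_countType_measurable d (T : sigmaRingType d) (I : countType)
    (D : set I) (F : I -> set T) :
  (forall i, D i -> measurable (F i)) -> measurable (\bigcup_(i in D) F i).
Proof.
move=> mF; rewrite bigcup_mkcond; apply: countable_bigcupT_measurable => // i.
by case: ifPn => // /set_mem; exact: mF.
Qed.

(** * Measurability of maps into products *)

Section borel_maps.
Context d (Om : measurableType d).

Lemma measurable_borel_preimage (T : ptopologicalType) (f : Om -> T)
    (A : set (borel T)) :
  @measurable_fun _ _ Om (borel T) setT f -> measurable A ->
  measurable (f @^-1` A).
Proof. by move=> mf mA; rewrite -[_ @^-1` _]setTI; exact: mf. Qed.

(** An open set of the product is the union of the basic rectangles that it contains, and there are
    countably many of these. *)
Lemma measurable_borel_pair (S T : ptopologicalType) (f : Om -> S)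
    (g : Om -> T) : @second_countable S -> @second_countable T ->
  @measurable_fun _ _ Om (borel S) setT f ->
  @measurable_fun _ _ Om (borel T) setT g ->
  @measurable_fun _ _ Om (borel (S * T)%type) setT (fun x => (f x, g x)).
Proof.
move=> /second_countableP[A bA] /second_countableP[B bB] mf mg.
have [Ao Ab] := bA; have [Bo Bb] := bB.
apply: (@measurability _ _ Om (borel (S * T)%type) setT _ open) => //.
move=> _ [U oU <-]; rewrite setTI.
rewrite (_ : _ @^-1` U = \bigcup_(p in [set p : nat * nat |
    A p.1 `*` B p.2 `<=` U]) (f @^-1` A p.1 `&` g @^-1` B p.2)); last first.
  apply/seteqP; split=> [x Ux|x [p pU [Ax Bx]]]; last exact: pU.
  have [V [W [Vo Vx Wo Wy VWU]]] := open_prod_nbhs oU Ux.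
  have [i [Ai iV]] := Ab _ _ Vo Vx; have [j [Bj jW]] := Bb _ _ Wo Wy.
  exists (i, j) => //= -[a b] [/= /iV Va /jW Wb]; exact: VWU.
apply: bigcup_countType_measurable => p _; apply: measurableI.
  by apply: measurable_borel_preimage => //; exact: open_borel.
by apply: measurable_borel_preimage => //; exact: open_borel.
Qed.

Lemma measurable_borel_ptws (I : countType) (T : ptopologicalType)
    (f : Om -> {ptws I -> T}) : @second_countable T ->
  (forall i, @measurable_fun _ _ Om (borel T) setT (fun x => f x i)) ->
  @measurable_fun _ _ Om (borel {ptws I -> T}) setT f.
Proof.
move=> /second_countableP[B bB] mf; have [Bo Bb] := bB.
apply: (@measurability _ _ Om (borel {ptws I -> T}) setT _ open) => //.
move=> _ [U oU <-]; rewrite setTI.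
rewrite (_ : _ @^-1` U = \bigcup_(l in [set l | ptws_cylinder B l `<=` U])
    (f @^-1` ptws_cylinder B l)); last first.
  apply/seteqP; split=> [x Ux|x [l lU lx]]; last exact: lU.
  by have [l [lx lU]] := ptws_cylinder_base bB oU Ux; exists l.
apply: bigcup_countType_measurable => l _.
elim: l => [|[i n] l IH].
  by rewrite (_ : _ @^-1` _ = setT) //; exact/seteqP.
rewrite ptws_cylinder_cons preimage_setI; apply: measurableI => //.
by apply: (measurable_borel_preimage (mf i)); exact: open_borel.
Qed.

End borel_maps.

(** The product measure in [dGW_infty] lives on the product sigma-algebra, while its support is
    tested on open sets of the product topology; the identity map between the two structures is
    measurable. *)
Lemma borel_setX_measurable (S T : ptopologicalType) (U : set (S * T)) :
  @second_countable S -> @second_countable T -> open U ->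
  @measurable _ (borel S * borel T)%type U.
Proof.
move=> cS cT oU.
have -> : U = (fun z : borel S * borel T => (fst z, snd z)) @^-1` U.
  by apply/seteqP; split=> -[].
apply: measurable_borel_preimage; last exact: open_borel.
exact: measurable_borel_pair.
Qed.

(** * Supports of measures *)

Lemma supp_closed (R : realType) (T : topologicalType) (mu : set T -> \bar R) :
  closed (supp mu).
Proof.
move=> x clx U oU Ux.
by have [y [sy Uy]] := clx U (open_nbhs_nbhs (conj oU Ux)); exact: sy.
Qed.

Section support.
Context (R : realType) (T : ptopologicalType) (mu : {measure set (borel T) -> \bar R}).

Lemma supp_subset (F : set T) : closed F -> mu (~` F) = 0%E -> supp mu `<=` F.
Proof.
move=> cF F0 x sx; apply: contrapT => nFx.
by have := sx _ (closed_openC cF) nFx; rewrite F0 ltxx.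
Qed.

(** A point outside the support has a null open neighbourhood, hence a null basic one, and countably
    many null basic sets have a null union. *)
Lemma supp_full : @second_countable T -> mu (~` supp mu) = 0%E.
Proof.
move=> /second_countableP[B bB]; have [Bo Bb] := bB.
have null : mu.-negligible (\bigcup_(n in [set n | mu (B n) = 0%E]) B n).
  rewrite bigcup_mkcond; apply: negligible_bigcup => n.
  case: ifPn => [|_]; last exact: negligible_set0.
  by rewrite inE => n0; apply/negligibleP => //; exact: open_borel.
have ms : measurable (~` supp mu : set (borel T)).
  by apply: open_borel; exact/closed_openC/supp_closed.
apply/negligibleP => //; apply: negligibleS null => x.
move=> /existsNP[U /not_implyP[oU /not_implyP[Ux /negP]]].
rewrite -leNgt measure_le0 => /eqP U0.
have [n [Bx BU]] := Bb _ _ oU Ux; exists n => //=.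
apply/eqP; rewrite -measure_le0 -U0 le_measure ?inE//; exact: open_borel.
Qed.

End support.

Lemma polish_dense_sequence (R : realType) (X : polishMetricType R) :
  exists f : nat -> X, forall (x : X) (e : R), 0 < e ->
    exists k, mdist (f k) x < e.
Proof.
have [D cD dD] := @separable _ X.
have [f fD] : exists f : nat -> X, D `<=` range f.
  have /pfcard_geP[D0|[f]] := cD.
    by exists (fun=> point) => x; rewrite D0.
  by exists f; exact: surj.
exists f => x e e0.
have [y [/interior_subset xy Dy]] : (ball x e)° `&` D !=set0.
  by apply: dD; [exists x; exact: nbhsx_ballx|exact: open_interior].
have [k _ fk] := fD y Dy; exists k; rewrite fk.
by move: xy; rewrite ballEmdist/= metric_sym.
Qed.

Lemma mball_open (R : realType) (X : metricType R) (x : X) (e : R) :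
  open [set y : X | mdist x y < e].
Proof.
rewrite openE => y /= xy; rewrite /interior.
rewrite -metricType_numDomainType.filter_from_mdist_nbhs.
exists (e - mdist x y); first by rewrite /= subr_gt0.
move=> z /= yz; rewrite (le_lt_trans (metric_triangle _ y _))//.
by rewrite addrC -ltrBrDr.
Qed.

Lemma open_mball (R : realType) (X : metricType R) (x : X) (U : set X) :
  open U -> U x -> exists2 e : R, 0 < e & [set y | mdist x y < e] `<=` U.
Proof.
move=> oU Ux; have := open_nbhs_nbhs (conj oU Ux).
by rewrite -metricType_numDomainType.filter_from_mdist_nbhs.
Qed.

(** * Probability measures on sequences of bits *)

Definition image_law d d' (T : measurableType d) (T' : measurableType d')
    (R : realType) (P : probability T R) (f : T -> T')
    (mf : measurable_fun setT f) : probability T' R :=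
  distribution P (mfun_Sub (mem_set mf)).

Lemma image_lawE d d' (T : measurableType d) (T' : measurableType d')
    (R : realType) (P : probability T R) (f : T -> T')
    (mf : measurable_fun setT f) A :
  image_law P mf A = P (f @^-1` A).
Proof. by []. Qed.

Lemma mkseq_rcons T (b : nat -> T) n : mkseq b n.+1 = rcons (mkseq b n) (b n).
Proof. by rewrite /mkseq -addn1 iotaD map_cat cats1 add0n. Qed.

Definition bit_sets : set (set (nat -> bool)) :=
  range (fun k => [set b : nat -> bool | b k]).
Notation code := (g_sigma_algebraType bit_sets).

Definition cyl (s : seq bool) : set code := [set b : nat -> bool | mkseq b (size s) = s].

Lemma measurable_bit k : measurable ([set b : nat -> bool | b k] : set code).
Proof. by apply: sub_sigma_algebra; exists k. Qed.

Lemma measurable_to_code d (T : measurableType d) (f : T -> code) :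
  (forall k, measurable [set t | f t k]) -> measurable_fun setT f.
Proof.
move=> mf; apply: (@measurability _ _ T code setT f bit_sets) => //.
by move=> _ [_ [k _ <-] <-]; rewrite setTI; exact: mf.
Qed.

Lemma code_bit_measurable d (T : measurableType d) (f : T -> code) k :
  measurable_fun setT f -> measurable [set t | f t k].
Proof.
move=> mf; rewrite -[X in measurable X]setTI.
by apply: (mf measurableT [set b : nat -> bool | b k]); exact: measurable_bit.
Qed.

Lemma cyl_nil : cyl [::] = setT.
Proof. exact/seteqP. Qed.

Lemma cyl_rcons s a : cyl (rcons s a) = cyl s `&` [set b : nat -> bool | b (size s) = a].
Proof.
rewrite /cyl; apply/seteqP; split=> b /=; rewrite size_rcons mkseq_rcons.
  by move=> /rcons_inj[].
by move=> [-> ->].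
Qed.

Lemma cyl_split s : cyl s = cyl (rcons s false) `|` cyl (rcons s true).
Proof.
rewrite !cyl_rcons -setIUr; apply/esym/setIidPl => b _ /=.
by case: (b _); [right|left].
Qed.

Lemma cyl_disj s : cyl (rcons s false) `&` cyl (rcons s true) = set0.
Proof.
by rewrite !cyl_rcons; apply/seteqP; split=> // b [[_ /= ->] [_ /=]].
Qed.

Lemma measurable_cyl s : measurable (cyl s).
Proof.
elim/last_ind: s => [|s a IH]; first by rewrite cyl_nil.
rewrite cyl_rcons; apply: measurableI => //.
case: a; first exact: measurable_bit.
rewrite (_ : mkset _ = ~` [set b : nat -> bool | b (size s)]).
  by apply: measurableC; exact: measurable_bit.
by apply/seteqP; split=> b /=; case: (b _).
Qed.

Lemma cylP s b : cyl s b <-> forall k, (k < size s)%N -> b k = nth false s k.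
Proof.
split=> [<- k|bs]; first by rewrite size_mkseq => kn; rewrite nth_mkseq.
apply: (@eq_from_nth _ false); rewrite size_mkseq// => k kn.
by rewrite nth_mkseq ?bs.
Qed.

Lemma cyl_sub s s' b : cyl s b -> cyl s' b -> (size s <= size s')%N ->
  cyl s' `<=` cyl s.
Proof.
move=> /cylP bs /cylP bs' ss' c /cylP cs'; apply/cylP => k ks.
by rewrite cs' ?(leq_trans ks)// -bs' ?bs// (leq_trans ks).
Qed.

(** Two cylinders are nested or disjoint, so together with the empty set they are closed under
    intersection. They generate the bit events: bit [k] is set on the union of the cylinders of
    [rcons s true] over words [s] of length [k]. *)
Lemma code_measure_unique (R : realType) (m1 m2 : {measure set code -> \bar R}) :
  (m1 setT < +oo)%E -> (forall s, m1 (cyl s) = m2 (cyl s)) ->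
  forall A, measurable A -> m1 A = m2 A.
Proof.
move=> m1oo m12 A mA.
pose G : set (set code) := [set cyl s | s in setT] `|` [set set0].
have Gm : G `<=` measurable.
  by move=> _ [[s _ <-]|->]; [exact: measurable_cyl|exact: measurable0].
apply: (@g_sigma_algebra_measure_unique _ R code G Gm (fun=> setT)).
- by move=> _; left; exists [::] => //; exact: cyl_nil.
- by apply/seteqP; split=> // x _; exists 0%N.
- move=> _ _ [[s _ <-]|->] [[s' _ <-]|->]; rewrite ?setI0 ?set0I; try by right.
  have [->|/set0P[b [bs bs']]] := eqVneq (cyl s `&` cyl s') set0; first by right.
  left; have [ss'|/ltnW s's] := leqP (size s) (size s').
    by exists s' => //; apply/esym/setIidPr; exact: cyl_sub bs bs' ss'.
  by exists s => //; apply/esym/setIidPl; exact: cyl_sub bs' bs s's.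
- by move=> _ [[s _ <-]|->]; rewrite ?measure0.
- by move=> _.
- suff : <<s bit_sets >> `<=` <<s G >> by apply.
  apply: smallest_sub; first exact: smallest_sigma_algebra.
  move=> _ [k _ <-].
  rewrite (_ : mkset _ = \bigcup_(s in [set s | size s = k]) cyl (rcons s true)).
    apply: (@bigcup_countType_measurable _ (g_sigma_algebraType G)) => s _.
    by apply: sub_sigma_algebra; left; exists (rcons s true).
  apply/seteqP; split=> [b bk|b [s /= sk]].
    by exists (mkseq b k); rewrite /= ?cyl_rcons ?size_mkseq; split=> //=;
      rewrite /cyl /= size_mkseq.
  by rewrite cyl_rcons sk => -[].
Qed.

(** Additivity along the binary tree carries an identity from depth [n] up to the root. In the
    applications [E] reads only the first [n] bits, so that at depth [n] each cylinder lies inside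
    [E] or misses it. *)
Lemma cyl_induction (R : realType) (P : probability code R) (n : nat)
    (F : seq bool -> \bar R) (E : set code) : measurable E ->
  (forall s, (size s < n)%N -> F s = (F (rcons s false) + F (rcons s true))%E) ->
  (forall s, size s = n -> P (cyl s `&` E) = F s) ->
  P E = F [::].
Proof.
move=> mE FD Fn; rewrite -[E]setTI -cyl_nil.
suff H k s : (size s + k)%N = n -> P (cyl s `&` E) = F s by exact: (H n).
elim: k s => [|k IH] s; first by rewrite addn0; exact: Fn.
move=> sk; rewrite FD; last by rewrite -sk addnS ltnS leq_addr.
rewrite -!IH ?size_rcons ?addSnnS// [in LHS]cyl_split setIUl measureU//.
- by apply: measurableI => //; exact: measurable_cyl.
- by apply: measurableI => //; exact: measurable_cyl.
- by rewrite setIACA cyl_disj set0I.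
Qed.

(** * Laws on bit sequences with prescribed masses of cylinders *)

Section unit_interval.
Variable R : realType.

Let munit : measurable (`[0%R, 1%R[%classic : set (measurableTypeR R)).
Proof. exact: measurable_itv. Qed.

Definition unit_lebesgue : set (measurableTypeR R) -> \bar R :=
  mrestr lebesgue_measure munit.

HB.instance Definition _ :=
  Measure.on unit_lebesgue.

Let unit_lebesgueT : unit_lebesgue setT = 1%E.
Proof.
rewrite /unit_lebesgue /mrestr setTI lebesgue_measure_itv/= lte_fin ltr01.
by rewrite oppr0 adde0.
Qed.

HB.instance Definition _ :=
  Measure_isProbability.Build _ _ _ unit_lebesgue unit_lebesgueT.

End unit_interval.

Section code_measure.
Variables (R : realType) (w : seq bool -> R).
Hypothesis w0 : forall s, 0 <= w s.
Hypothesis w1 : w [::] = 1.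
Hypothesis wD : forall s, w s = w (rcons s false) + w (rcons s true).

(** The left end of the interval of [s]: every letter [true] skips the interval of its sibling with
    letter [false]. *)
Let low (s : seq bool) : R :=
  \sum_(k < size s | nth false s k) w (rcons (take k s) false).

Let low_rcons s a :
  low (rcons s a) = low s + (if a then w (rcons s false) else 0).
Proof.
rewrite /low size_rcons [LHS]big_mkcond big_ord_recr/=.
rewrite nth_rcons ltnn eqxx [in RHS]big_mkcond/=; congr (_ + _).
  apply: eq_bigr => i _; rewrite nth_rcons ltn_ord.
  by rewrite -[rcons s a]cats1 takel_cat// ltnW.
by rewrite -[rcons s a]cats1 take_size_cat.
Qed.

Let bit (t : R) (s : seq bool) := low s + w (rcons s false) <= t.

Let Fixpoint path (t : R) (n : nat) : seq bool :=
  if n is n'.+1 then rcons (path t n') (bit t (path t n')) else [::].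

Let expansion (t : R) : code := fun n => bit t (path t n).

Let mkseq_expansion t n : mkseq (expansion t) n = path t n.
Proof. by elim: n => // n IH; rewrite mkseq_rcons IH. Qed.

(* The cylinders partition [0, 1[ into intervals of lengths [w s]. *)
Let expansionP t s : 0 <= t < 1 ->
  cyl s (expansion t) <-> low s <= t < low s + w s.
Proof.
move=> t01; elim/last_ind: s => [|s a IH].
  by rewrite cyl_nil /low big_ord0 add0r w1.
rewrite cyl_rcons low_rcons; have wDs := wD s.
have wf := w0 (rcons s false); have wt := w0 (rcons s true).
have bitE : cyl s (expansion t) -> expansion t (size s) = bit t s.
  by move=> st; rewrite /expansion -mkseq_expansion st.
split=> [[st /=]|/andP[la lb]].
  rewrite bitE//; move/IH: st => /andP[la lb] <-; rewrite /bit.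
  by case: (leP (low s + w (rcons s false)) t) => /= ?; apply/andP; split; lra.
have st : cyl s (expansion t).
  by apply/IH; case: a la lb => /= ? ?; apply/andP; split; lra.
split=> //=; rewrite bitE// /bit; case: a la lb => /= la lb.
  by apply/idP; lra.
by apply/negbTE; rewrite -ltNge; lra.
Qed.

Let low_bounds s : 0 <= low s /\ low s + w s <= 1.
Proof.
elim/last_ind: s => [|s a [l0 l1]].
  by rewrite /low big_ord0 add0r w1.
rewrite low_rcons; have wDs := wD s.
have wf := w0 (rcons s false); have wt := w0 (rcons s true).
by case: a; split; lra.
Qed.

Let measurable_path n s : measurable [set t : measurableTypeR R | path t n = s].
Proof.
elim: n s => [|n IH] s /=.
  have [<-|s0] := eqVneq [::] s.
    by rewrite (_ : mkset _ = setT)//; exact/seteqP.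
  by rewrite (_ : mkset _ = set0)//; apply/seteqP; split=> // t /eqP; rewrite (negbTE s0).
rewrite (_ : mkset _ = \bigcup_(u in [set: seq bool])
   ([set t | path t n = u] `&`
    [set t | rcons u (low u + w (rcons u false) <= t) = s])); last first.
  apply/seteqP; split=> [t pt|t [u _ [/= <-]]//].
  by exists (path t n).
apply: bigcup_countType_measurable => u _; apply: measurableI => //.
have mu : measurable [set t : measurableTypeR R | low u + w (rcons u false) <= t].
  rewrite (_ : mkset _ = `[low u + w (rcons u false), +oo[%classic).
    exact: measurable_itv.
  by apply/seteqP; split=> t; rewrite /= in_itv/= andbT.
have [->|st] := eqVneq s (rcons u true).
  rewrite (_ : mkset _ = [set t | low u + w (rcons u false) <= t])//.
  by apply/seteqP; split=> t /=; [move=> /rcons_inj[]|move=> ->].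
have [->|sf] := eqVneq s (rcons u false).
  rewrite (_ : mkset _ = ~` [set t | low u + w (rcons u false) <= t]).
    exact: measurableC.
  apply/seteqP; split=> t /=; first by move=> /rcons_inj[->].
  by move=> /negP/negbTE ->.
rewrite (_ : mkset _ = set0)//; apply/seteqP; split=> // t /=.
by case: leP => _ /eqP; rewrite eq_sym ?(negbTE st) ?(negbTE sf).
Qed.

Let measurable_expansion :
  @measurable_fun _ _ (measurableTypeR R) code setT expansion.
Proof.
apply: measurable_to_code => k; rewrite /expansion.
rewrite (_ : mkset _ = \bigcup_(u in [set: seq bool])
   ([set t | path t k.+1 = rcons u true])).
  by apply: bigcup_countType_measurable => u _; exact: measurable_path.
apply/seteqP; split=> [t /= bt|t [u _ /= /rcons_inj[]//]].
by exists (path t k) => //=; rewrite bt.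
Qed.

(** The law of [expansion] under Lebesgue measure gives [cyl s] the length of its interval, and
    countable additivity is inherited from Lebesgue measure. *)
Lemma code_measure_exists :
  exists P : probability code R, forall s, P (cyl s) = (w s)%:E.
Proof.
exists (image_law (@unit_lebesgue R) measurable_expansion) => s.
rewrite image_lawE.
rewrite -[LHS]/(lebesgue_measure ((expansion @^-1` cyl s) `&`
  `[0%R, 1%R[%classic)).
have [l0 l1] := low_bounds s.
rewrite (_ : _ `&` _ = `[low s, low s + w s[%classic).
  rewrite lebesgue_measure_itv/= lte_fin; case: ifPn => [_|].
    by rewrite -EFinD addrAC subrr add0r.
  (* The interval is empty here, which forces [w s] to be 0. *)
  by have := w0 s; rewrite ltrDl -leNgt => ? ?; congr EFin; lra.
apply/seteqP; split=> t /=; rewrite !in_itv/=.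
  by move=> [st t01]; apply/expansionP.
move=> lt; have t01 : 0 <= t < 1.
  by move: lt => /andP[? ?]; apply/andP; split; lra.
by split=> //; apply/expansionP.
Qed.

End code_measure.

(** * Codings of Polish spaces *)

Definition coding (T : ptopologicalType) (phi : borel T -> code)
    (psi : code -> borel T) :=
  [/\ measurable_fun setT phi, measurable_fun setT psi & cancel phi psi].

Lemma code_fun_measurable (h : nat -> nat) :
  @measurable_fun _ _ code code setT (fun b k => b (h k)).
Proof. by apply: measurable_to_code => k; exact: measurable_bit. Qed.

Definition interleave (b c : nat -> bool) : nat -> bool :=
  fun k => if odd k then c k./2 else b k./2.

Definition evens (b : nat -> bool) : nat -> bool := fun k => b k.*2.
Definition odds (b : nat -> bool) : nat -> bool := fun k => b k.*2.+1.

Lemma evens_interleave b c : evens (interleave b c) = b.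
Proof. by apply/funext => k; rewrite /evens /interleave odd_double doubleK. Qed.

Lemma odds_interleave b c : odds (interleave b c) = c.
Proof.
by apply/funext => k; rewrite /odds /interleave/= odd_double/= uphalf_double.
Qed.

Lemma measurable_evens : @measurable_fun _ _ code code setT evens.
Proof. exact: code_fun_measurable. Qed.

Lemma measurable_odds : @measurable_fun _ _ code code setT odds.
Proof. exact: code_fun_measurable. Qed.

Section prod_coding.
Variables (S T : ptopologicalType).
Hypotheses (cS : @second_countable S) (cT : @second_countable T).
Variables (phiS : borel S -> code) (psiS : code -> borel S).
Variables (phiT : borel T -> code) (psiT : code -> borel T).
Hypotheses (codS : coding phiS psiS) (codT : coding phiT psiT).

Definition prod_encode (z : borel (S * T)%type) : code :=
  interleave (phiS z.1) (phiT z.2).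

Definition prod_decode (b : code) : borel (S * T)%type :=
  (psiS (evens b), psiT (odds b)).

Lemma prod_coding : coding prod_encode prod_decode.
Proof.
have [mphiS mpsiS psiSK] := codS; have [mphiT mpsiT psiTK] := codT.
split.
- have mfst : @measurable_fun _ _ (borel (S * T)%type) (borel S) setT fst.
    by apply: continuous_borel_measurable => z; exact: cvg_fst.
  have msnd : @measurable_fun _ _ (borel (S * T)%type) (borel T) setT snd.
    by apply: continuous_borel_measurable => z; exact: cvg_snd.
  apply: measurable_to_code => k; rewrite /prod_encode /interleave.
  case: (odd k).
    exact: (code_bit_measurable k./2 (measurableT_comp mphiT msnd)).
  exact: (code_bit_measurable k./2 (measurableT_comp mphiS mfst)).
- apply: measurable_borel_pair => //.
    exact: (measurableT_comp mpsiS measurable_evens).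
  exact: (measurableT_comp mpsiT measurable_odds).
- move=> [x y]; rewrite /prod_decode /prod_encode.
  by rewrite evens_interleave odds_interleave psiSK psiTK.
Qed.

End prod_coding.

(** * Coding a point by its distances to a dense sequence *)

Section polish_coding.
Variables (R : realType) (X : polishMetricType R) (f : nat -> X).
Hypothesis denseX : forall (x : X) e, 0 < e -> exists k, mdist (f k) x < e.

Let r n : R := 2^-1 ^+ n.

Let r_gt0 n : 0 < r n. Proof. exact: exprn_gt0. Qed.

Let rS n : r n.+1 = r n / 2. Proof. by rewrite /r exprSr. Qed.

Let r_small e : 0 < e -> exists n, r n < e.
Proof.
move=> e0; have /cvgrPdist_lt/(_ e e0)[n _ /(_ n (leqnn n))/=] :
    (r n @[n --> \oo] --> (0 : R)).
  by apply: cvg_expr; rewrite gtr0_norm// invf_lt1// ltr1n.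
by rewrite sub0r normrN gtr0_norm//; exists n.
Qed.

Let dec (j : nat) : nat * nat := odflt (0, 0)%N (unpickle j).

Definition polish_encode (x : borel X) : code :=
  fun j => mdist (f (dec j).2) x < r (dec j).1.

Let bitb (b : code) (m k : nat) : bool := b (pickle (m, k)).

Let center (m : nat) (b : code) : nat :=
  if pselect (exists k, bitb b m k) is left h then ex_minn h else 0%N.

(** An arbitrary bit sequence need not encode a point. Refusing jumps of length at least [2 * r m']
    makes the walk Cauchy for every [b], so that decoding is total. For the code of a point,
    consecutive centers are less than [r m' + r m'.+1] apart and no jump is refused. *)
Let Fixpoint walk (b : code) (m : nat) : nat :=
  if m is m'.+1 then
    if mdist (f (walk b m')) (f (center m b)) < 2 * r m' then center m b
    else walk b m'
  else center 0 b.

Let walk_step b m : mdist (f (walk b m)) (f (walk b m.+1)) <= 2 * r m.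
Proof.
rewrite /=; case: ifPn => [/ltW//|_].
by rewrite mdistxx mulr_ge0// ltW.
Qed.

(** A telescoping form of the geometric series: [2 * r m] equals [4 * r m - 4 * r m.+1]. *)
Let walk_dist b m p :
  mdist (f (walk b m)) (f (walk b (m + p)%N)) <= 4 * r m - 4 * r (m + p)%N.
Proof.
elim: p => [|p IH]; first by rewrite addn0 mdistxx subrr.
rewrite addnS (le_trans (metric_triangle _ (f (walk b (m + p)%N)) _))//.
have := walk_step b (m + p); rewrite rS; move: IH.
set a := mdist _ _; set c := mdist _ _; lra.
Qed.

Let walk_cvg b : cvg (f (walk b m) @[m --> \oo]).
Proof.
apply/cauchy_cvgP/cauchy_exP => e e0.
have [m re] : exists m, r m < e / 4 by apply: r_small; rewrite divr_gt0.
exists (f (walk b m)); exists m => // n /= mn.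
rewrite ballEmdist/= -(subnKC mn) (le_lt_trans (walk_dist _ _ _))//.
by have := r_gt0 (m + (n - m)); lra.
Qed.

Definition polish_decode (b : code) : borel X := lim (f (walk b m) @[m --> \oo]).

Let decode_dist b m : mdist (f (walk b m)) (polish_decode b) <= 4 * r m.
Proof.
apply/ler_addgt0Pr => e e0.
have /metricType_numDomainType.cvgrPdist_lt/(_ e e0)[n _ nP] :
    f (walk b m) @[m --> \oo] --> (polish_decode b : X) by exact: walk_cvg.
have /= := nP (m + n)%N (leq_addl _ _); rewrite metric_sym => we.
apply: le_trans (metric_triangle _ (f (walk b (m + n)%N)) _) _.
apply: lerD; last exact: ltW.
by rewrite (le_trans (walk_dist _ _ _))// gerBl mulr_ge0// ltW.
Qed.

Let measurable_bitb m k : measurable [set b | bitb b m k].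
Proof. exact: measurable_bit. Qed.

Let measurable_center m k : measurable [set b | center m b = k].
Proof.
pose none := ~` \bigcup_l [set b | bitb b m l].
have mnone : measurable none.
  by apply: measurableC; exact: bigcup_measurable.
pose first := [set b | bitb b m k] `\` \bigcup_(l in [set l | (l < k)%N])
  [set b | bitb b m l].
have mfirst : measurable first.
  by apply: measurableD => //; exact: bigcup_measurable.
have centerN b : none b -> center m b = 0%N.
  move=> nb; rewrite /center; case: pselect => // -[l bl].
  by case: nb; exists l.
have centerP b : ~ none b -> bitb b m (center m b) /\
    forall l, bitb b m l -> (center m b <= l)%N.
  move=> /contrapT [l _ bl]; rewrite /center; case: pselect => [h|[]]; last by exists l.
  by case: ex_minnP.
(* The value 0 is also the default when no bit is set at scale [m], hence the extra set [none]. *)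
rewrite (_ : mkset _ = first `|` (if k == 0%N then none else set0)).
  by apply: measurableU => //; case: ifPn.
apply/seteqP; split=> b /=.
  have [nb|/centerP[bc bm]] := pselect (none b).
    by rewrite centerN// => <-; right; rewrite eqxx.
  move=> ck; left; rewrite /first -ck; split=> // -[l /= lk /bm].
  by rewrite leqNgt lk.
move=> [[bk nbl]|].
  have [|bc bm] := centerP b; first by move=> nb; apply: nb; exists k => //; exact: bk.
  apply/eqP; rewrite eqn_leq bm//= leqNgt; apply/negP => ck.
  by apply: nbl; exists (center m b).
by case: eqP => // -> /centerN.
Qed.

Let measurable_walk m k : measurable [set b | walk b m = k].
Proof.
elim: m k => [|m IH] k; first exact: measurable_center.
pose next (p : nat * nat) :=
  if mdist (f p.1) (f p.2) < 2 * r m then p.2 else p.1.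
rewrite (_ : mkset _ = \bigcup_(p in [set p | next p = k])
   ([set b | walk b m = p.1] `&` [set b | center m.+1 b = p.2])).
  apply: bigcup_countType_measurable => p _; apply: measurableI.
    exact: (IH p.1).
  exact: (measurable_center m.+1 p.2).
apply/seteqP; split=> [b bk|b [[i j] /= ijk [wi cj]]].
  by exists (walk b m, center m.+1 b).
by rewrite /= wi cj.
Qed.

Lemma measurable_polish_decode : measurable_fun setT polish_decode.
Proof.
apply: (@measurability _ _ code (borel X) setT _ open) => //.
move=> _ [U oU <-]; rewrite setTI.
(* The limit is within [4 * r m] of the walk at stage [m]; a ball of the strictly larger radius
   [5 * r m] inside [U] therefore certifies membership, and such a certificate depends only on one
   value of the walk. *)
rewrite (_ : _ @^-1` U = \bigcup_(p in [set p : nat * nat |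
    ball (f p.2) (5 * r p.1) `<=` U]) [set b | walk b p.1 = p.2]).
  by apply: bigcup_countType_measurable => p _; exact: (measurable_walk p.1 p.2).
apply/seteqP; split=> [b /= bU|b [[m k] /= kU wk]]; last first.
  apply: kU; rewrite ballEmdist/= -wk (le_lt_trans (decode_dist _ _))//.
  by rewrite ltr_pM2r// ltr_nat.
have [e e0 eU] := open_mball oU bU.
(* The ball of radius [5 * r m] around a point at distance at most [4 * r m] from the limit stays
   within [9 * r m] of it. *)
have [m re] : exists m, r m < e / 9 by apply: r_small; rewrite divr_gt0.
exists (m, walk b m) => //= y; rewrite ballEmdist/= => wy; apply: eU => /=.
rewrite (le_lt_trans (metric_triangle _ (f (walk b m)) _))// metric_sym.
by have := decode_dist b m; lra.
Qed.

Let pickle_dec m k : dec (pickle (m, k)) = (m, k).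
Proof. by rewrite /dec pickleK. Qed.

Lemma measurable_polish_encode : measurable_fun setT polish_encode.
Proof.
apply: measurable_to_code => j; apply: open_borel.
exact: mball_open.
Qed.

(** The bits are balls around dense points. Positivity of a coupling on products of bit events is
    thus enough to locate its support. *)
Lemma polish_encode_base : base_seq (fun j => [set x : X | polish_encode x j]).
Proof.
split=> [j|x U oU Ux]; first exact: mball_open.
have [e e0 eU] := open_mball oU Ux.
have [m re] : exists m, r m < e / 2 by apply: r_small; rewrite divr_gt0.
have [k kx] := denseX x (r_gt0 m).
exists (pickle (m, k)); rewrite /polish_encode pickle_dec/=; split=> // y /= ky.
apply: eU => /=; rewrite (le_lt_trans (metric_triangle _ (f k) _))//.
by rewrite metric_sym; lra.
Qed.

Lemma polish_encodeK : cancel polish_encode polish_decode.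
Proof.
move=> x; have cP m : mdist (f (center m (polish_encode x))) x < r m.
  rewrite /center; case: pselect => [h|].
    by case: ex_minnP => k; rewrite /bitb /polish_encode pickle_dec.
  have [k kx] := denseX x (r_gt0 m).
  by case; exists k; rewrite /bitb /polish_encode pickle_dec.
have wE m : walk (polish_encode x) m = center m (polish_encode x).
  elim: m => // m /= ->; case: ifPn => // /negP[].
  rewrite (le_lt_trans (metric_triangle _ x _))//.
  have := cP m; have := cP m.+1; rewrite rS [X in X < _]metric_sym.
  by have := r_gt0 m; lra.
apply: cvg_lim; first exact: metric_hausdorff.
apply/metricType_numDomainType.cvgrPdist_lt => e e0.
have [m re] := r_small e0; exists m => // n /= mn.
rewrite metric_sym wE (lt_trans (cP n))// (le_lt_trans _ re)//.
by rewrite /r ler_wiXn2l// ?invr_ge0// invf_le1// ler1n.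
Qed.

End polish_coding.

Lemma polish_coding_exists (R : realType) (X : polishMetricType R) :
  exists (phi : borel X -> code) (psi : code -> borel X), coding phi psi /\
    base_seq (fun j => [set x : X | phi x j]).
Proof.
have [f fd] := polish_dense_sequence X.
exists (polish_encode f), (polish_decode f); split; last exact: polish_encode_base.
split; [exact: measurable_polish_encode|exact: measurable_polish_decode|].
exact: polish_encodeK.
Qed.

Lemma polish_second_countable (R : realType) (X : polishMetricType R) :
  @second_countable X.
Proof.
have [phi [_ [_ bX]]] := polish_coding_exists X.
exact: base_seq_second_countable bX.
Qed.

(** * Product laws *)

Lemma prod_EFin (R : realType) I (s : seq I) (P : pred I) (f : I -> R) :
  (\big[mule/1]_(i <- s | P i) (f i)%:E = (\prod_(i <- s | P i) f i)%:E)%E.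
Proof. by rewrite (big_morph EFin (@EFinM R) (erefl _)). Qed.

Lemma fin_prob d (T : measurableType d) (R : realType) (P : probability T R) A :
  measurable A -> (fine (P A))%:E = P A.
Proof. by move=> mA; rewrite fineK// fin_num_measure. Qed.

(** Packages the dependence of a rectangle's mass on a single factor as a measure, so that
    uniqueness of measures on codes applies to that factor. *)
Lemma exists_restr_image d1 d2 (T1 : measurableType d1) (T2 : measurableType d2)
    (R : realType) (m : {measure set T1 -> \bar R}) (f : T1 -> T2) D :
  measurable D -> measurable_fun setT f ->
  exists m' : {measure set T2 -> \bar R}, forall A, m' A = m (f @^-1` A `&` D).
Proof.
move=> mD mf.
by exists (measure_function_pushforward__canonical__measure_function_Measure
  (mrestr m mD) mf).
Qed.

(** The pairing [2 ^ i * (2 k + 1) - 1] satisfies [pair_dec_le]: a prefix of length n then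
    constrains only points of index below n, and its mass is a finite product. *)
Definition pair_enc (i k : nat) : nat := (2 ^ i * k.*2.+1).-1.

Definition pair_dec (j : nat) : nat * nat :=
  (logn 2 j.+1, (j.+1 %/ 2 ^ logn 2 j.+1)./2).

Lemma pair_encK i k : pair_dec (pair_enc i k) = (i, k).
Proof.
have gt0 : (0 < 2 ^ i * k.*2.+1)%N by rewrite muln_gt0 expn_gt0.
rewrite /pair_dec /pair_enc prednK//.
have -> : logn 2 (2 ^ i * k.*2.+1) = i.
  rewrite lognM ?expn_gt0// pfactorK// [logn _ k.*2.+1]lognE.
  by rewrite dvdn2/= odd_double addn0.
by rewrite mulKn ?expn_gt0//= uphalf_double.
Qed.

Lemma pair_dec_le j : ((pair_dec j).1 <= j)%N.
Proof. by rewrite /pair_dec -ltnS ltn_logl. Qed.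

Section product_law_nat.
Context (R : realType) (T : ptopologicalType) (mu : probability (borel T) R).
Hypothesis cT : @second_countable T.
Variables (phi : borel T -> code) (psi : code -> borel T).
Hypothesis cod : coding phi psi.

Let mphi : measurable_fun setT phi. Proof. by case: cod. Qed.
Let mpsi : measurable_fun setT psi. Proof. by case: cod. Qed.
Let psiK : cancel phi psi. Proof. by case: cod. Qed.

(* The constraint that the prefix [s] puts on the code of the [i]-th point. *)
Let slice (s : seq bool) (i : nat) : set (borel T) :=
  [set x | forall j, (j < size s)%N -> (pair_dec j).1 = i ->
    phi x (pair_dec j).2 = nth false s j].

Let slice_rcons s a i : slice (rcons s a) i = slice s i `&`
  [set x | (pair_dec (size s)).1 = i -> phi x (pair_dec (size s)).2 = a].
Proof.
apply/seteqP; split=> x.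
  move=> sx; split=> [j js ji|/= ji].
    by rewrite sx ?size_rcons ?ltnS 1?ltnW// nth_rcons js.
  by rewrite sx// ?size_rcons// nth_rcons ltnn eqxx.
move=> [sx /= xa] j; rewrite size_rcons ltnS leq_eqVlt nth_rcons.
have [-> _ /xa->|_/= js] := eqVneq j (size s); first by rewrite ltnn.
by rewrite js; exact: sx.
Qed.

Let measurable_phi_bit k a : measurable [set x : borel T | phi x k = a].
Proof.
case: a; first exact: code_bit_measurable.
rewrite (_ : mkset _ = ~` [set x | phi x k]).
  by apply: measurableC; exact: code_bit_measurable.
by apply/seteqP; split=> x /=; case: (phi x k).
Qed.

Let measurable_slice s i : measurable (slice s i).
Proof.
elim/last_ind: s => [|s a IH].
  by rewrite (_ : slice _ _ = setT)//; exact/seteqP.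
rewrite slice_rcons; apply: measurableI => //.
have [e|ne] := eqVneq (pair_dec (size s)).1 i.
  rewrite (_ : mkset _ = [set x | phi x (pair_dec (size s)).2 = a]).
    exact: measurable_phi_bit.
  by apply/seteqP; split=> x /=; [exact|move=> ->].
rewrite (_ : mkset _ = setT)//; by apply/seteqP; split=> // x _ e; case/eqP: ne.
Qed.

Let slice_big s i : (size s <= i)%N -> slice s i = setT.
Proof.
move=> si; apply/seteqP; split=> // x _ j js ji.
by have := pair_dec_le j; rewrite ji leqNgt (leq_trans js).
Qed.

(** With [G] constantly [setT] this is the weight of a cylinder; a general [G] gives the mass that
    the cylinder of [s] should share with a rectangle, as needed for [cyl_induction]. *)
Let mass (G : nat -> set (borel T)) (n : nat) (s : seq bool) : R :=
  \prod_(i < n) fine (mu (slice s i `&` G i)).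

(** One more bit splits a single factor, that of the point whose code contains this bit. *)
Let massD G n s : (forall i, measurable (G i)) -> (size s < n)%N ->
  mass G n s = mass G n (rcons s false) + mass G n (rcons s true).
Proof.
move=> mG sn.
have i0n : ((pair_dec (size s)).1 < n)%N by exact: leq_ltn_trans (pair_dec_le _) _.
have D1 u : mass G n u = fine (mu (slice u (pair_dec (size s)).1 `&`
    G (pair_dec (size s)).1)) *
    \prod_(i < n | i != Ordinal i0n) fine (mu (slice u i `&` G i)).
  by rewrite /mass (bigD1 (Ordinal i0n)).
rewrite !D1.
have E a : \prod_(i < n | i != Ordinal i0n) fine (mu (slice (rcons s a) i `&` G i))
         = \prod_(i < n | i != Ordinal i0n) fine (mu (slice s i `&` G i)).
  apply: eq_bigr => i ii0; congr (fine (mu (_ `&` _))).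
  rewrite slice_rcons; apply/setIidPl => x _ e.
  by case/eqP: ii0; exact/val_inj/esym.
rewrite !E -mulrDl; congr (_ * _).
rewrite -fineD ?fin_num_measure//; try exact: measurableI.
rewrite -measureU//; try exact: measurableI.
  congr (fine (mu _)); rewrite !slice_rcons -setIUl -setIUr.
  congr (_ `&` _); apply/esym/setIidPl => x _ /=.
  by case: (phi x _); [right|left].
rewrite setIACA setIid !slice_rcons.
apply/seteqP; split=> // x [[[_ /=]]] /(_ erefl) -> [_ /=].
by move=> /(_ erefl).
Qed.

(** A point of index at least [size s] is not constrained by [s] and contributes the factor 1. *)
Let massT n s : (size s <= n)%N ->
  mass (fun=> setT) n s = mass (fun=> setT) (size s) s.
Proof.
move=> /subnKC <-; elim: (n - size s)%N => [|k IH]; first by rewrite addn0.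
rewrite addnS -IH /mass big_ord_recr/= slice_big ?leq_addr//.
by rewrite setIT probability_setT mulr1.
Qed.

Let exists_code_law : exists P : probability code R,
  forall s, P (cyl s) = (mass (fun=> setT) (size s) s)%:E.
Proof.
apply: code_measure_exists => [s||s].
- by apply: prodr_ge0 => i _; exact: fine_ge0.
- by rewrite /mass big_ord0.
- by rewrite -(@massT (size s).+1)// massD// !(@massT (size s).+1) ?size_rcons.
Qed.

Let row (i : nat) (b : code) : code := fun k => b (pair_enc i k).

Let measurable_row i : measurable_fun setT (row i).
Proof. exact: code_fun_measurable. Qed.

Section code_law.
Variable P : probability code R.
Hypothesis Pcyl : forall s, P (cyl s) = (mass (fun=> setT) (size s) s)%:E.

Let rect N (S : nat -> set code) : set code :=
  [set b | forall i, (i < N)%N -> S i (row i b)].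

Let measurable_rect N S : (forall i, measurable (S i)) -> measurable (rect N S).
Proof.
move=> mS; rewrite (_ : rect N S = \bigcap_(i in [set i | (i < N)%N])
  (row i @^-1` S i)); last by apply/seteqP; split.
apply: fin_bigcap_measurable => [|i _]; first exact: finite_II.
by rewrite -[_ @^-1` _]setTI; exact: measurable_row.
Qed.

Let mpre S : measurable S -> measurable (phi @^-1` S).
Proof. by move=> mS; rewrite -[_ @^-1` _]setTI; exact: mphi. Qed.

(** At a depth where all bits read by the words [t i] are known, a word either implies the rectangle
    or contradicts it. In the second case the factor of the offending point is the measure of the
    empty set. *)
Let rect_cyl N (t : nat -> seq bool) :
  P (rect N (cyl \o t)) = (\prod_(i < N) fine (mu (phi @^-1` cyl (t i))))%:E.
Proof.
pose G i : set (borel T) := if (i < N)%N then phi @^-1` cyl (t i) else setT.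
have mG i : measurable (G i).
  by rewrite /G; case: ifPn => // _; apply: mpre; exact: measurable_cyl.
(* Beyond all positions of bits read by [t], and at least [N] so that every constrained point has
   its factor. *)
pose n := (N + \max_(i < N) \max_(k < size (t i)) (pair_enc i k).+1)%N.
have Nn : (N <= n)%N by rewrite leq_addr.
have enc_n i k : (i < N)%N -> (k < size (t i))%N -> (pair_enc i k < n)%N.
  move=> iN kt; apply: leq_trans (leq_addl _ _).
  apply: leq_trans (leq_bigmax (Ordinal iN)).
  by rewrite (leq_trans _ (leq_bigmax (Ordinal kt))).
have mrect : measurable (rect N (cyl \o t)).
  by apply: measurable_rect => i; exact: measurable_cyl.
rewrite (@cyl_induction R P n (fun s => (mass G n s)%:E))//.
- congr EFin; rewrite /mass -(subnKC Nn) big_split_ord/= [X in _ * X]big1 ?mulr1.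
    apply: eq_bigr => i _; rewrite (_ : slice _ _ = setT) ?setTI; last first.
      exact/seteqP.
    by rewrite /G ltn_ord.
  move=> i _; rewrite /G ltnNge leq_addr/= setIT slice_big//.
  by rewrite probability_setT.
- by move=> s sn; rewrite massD.
- move=> s sn.
  have [st|] := pselect (forall i, (i < N)%N -> forall k, (k < size (t i))%N ->
      nth false s (pair_enc i k) = nth false (t i) k).
    rewrite (_ : _ `&` _ = cyl s); last first.
      apply/setIidPl => b /cylP bs i iN /=; apply/cylP => k kt.
      by rewrite /row bs ?sn ?enc_n// st.
    rewrite Pcyl sn; congr EFin; apply: eq_bigr => i _; congr (fine (mu _)).
    rewrite setIT; apply/esym/setIidPl => x xs; rewrite /G; case: ifPn => // iN.
    apply/cylP => k kt; rewrite -st//.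
    by have := xs (pair_enc i k); rewrite pair_encK sn; apply => //; exact: enc_n.
  move=> /existsNP[i /not_implyP[iN /existsNP[k /not_implyP[kt sk]]]].
  rewrite (_ : _ `&` _ = set0); last first.
    apply/seteqP; split=> // b [/cylP bs /(_ _ iN)/cylP/(_ _ kt)].
    by rewrite /row bs ?sn ?enc_n.
  rewrite measure0; congr EFin; apply/esym.
  rewrite /mass (bigD1 (Ordinal (leq_trans iN Nn)))//= (_ : _ `&` _ = set0).
    by rewrite measure0 mul0r.
  apply/seteqP; split=> // x [xs]; rewrite /G iN => /cylP/(_ _ kt) xk; apply: sk.
  rewrite -xk; have := xs (pair_enc i k); rewrite pair_encK sn => -> //.
  exact: enc_n.
Qed.

(** Cylinders are replaced by measurable sets one coordinate at a time: [j] counts the leading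
    coordinates where arbitrary sets are already allowed. As functions of the set at coordinate [j],
    both sides are finite measures that agree on cylinders. *)
Let rect_measurable N (S : nat -> set code) : (forall i, measurable (S i)) ->
  P (rect N S) = (\prod_(i < N) fine (mu (phi @^-1` S i)))%:E.
Proof.
suff H j : forall S : nat -> set code, (forall i, measurable (S i)) ->
    (forall i, (j <= i)%N -> exists t, S i = cyl t) ->
    P (rect N S) = (\prod_(i < N) fine (mu (phi @^-1` S i)))%:E.
  move=> mS; pose S' i := if (i < N)%N then S i else setT.
  have -> : rect N S = rect N S'.
    by apply/seteqP; split=> b bS i iN; have := bS i iN; rewrite /S' iN.
  rewrite (H N S').
  - by congr EFin; apply: eq_bigr => i _; rewrite /S' ltn_ord.
  - by move=> i; rewrite /S'; case: ifP.
  - by move=> i Ni; exists [::]; rewrite /S' ltnNge Ni cyl_nil.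
elim: j => [|j IH] {}S mS tS.
  have [t St] : exists t : nat -> seq bool, S = cyl \o t.
    have tS' i := cid (tS i isT).
    by exists (fun i => sval (tS' i)); apply/funext => i /=; exact: svalP (tS' i).
  by rewrite St rect_cyl.
(* For [N <= j] the rectangle does not read coordinate [j]; putting [setT], the cylinder of the
   empty word, on unread coordinates reduces to the previous case. *)
have [jN|Nj] := ltnP j N; last first.
  pose S' i := if (i < N)%N then S i else setT.
  have -> : rect N S = rect N S'.
    by apply/seteqP; split=> b bS i iN; have := bS i iN; rewrite /S' iN.
  rewrite IH.
  - by congr EFin; apply: eq_bigr => i _; rewrite /S' ltn_ord.
  - by move=> i; rewrite /S'; case: ifP.
  - by move=> i ji; exists [::]; rewrite /S' ltnNge (leq_trans Nj ji) cyl_nil.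
pose upd (A : set code) i := if i == j then A else S i.
have mupd A : measurable A -> forall i, measurable (upd A i).
  by move=> mA i; rewrite /upd; case: ifP.
have updE A : rect N (upd A) = row j @^-1` A `&` rect N (upd setT).
  apply/seteqP; split=> [b bA|b [bj bT] i iN].
    split=> [|i iN]; first by have := bA j jN; rewrite /upd eqxx.
    by have := bA i iN; rewrite /upd; case: ifP.
  by have := bT i iN; rewrite /upd; case: eqP => // ->.
have c0 : 0 <= \prod_(i < N | i != Ordinal jN) fine (mu (phi @^-1` S i)).
  by apply: prodr_ge0 => i _; exact: fine_ge0.
have prodE A : \prod_(i < N) fine (mu (phi @^-1` upd A i)) =
    (\prod_(i < N | i != Ordinal jN) fine (mu (phi @^-1` S i))) *
    fine (mu (phi @^-1` A)).
  rewrite (bigD1 (Ordinal jN))//= /upd eqxx mulrC; congr (_ * _).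
  by apply: eq_bigr => i; rewrite -val_eqE/= => /negbTE ->.
have [m1 m1E] := exists_restr_image P (measurable_rect N (mupd _ measurableT))
  (measurable_row j).
pose m2 : {measure set code -> \bar R} :=
  mscale (NngNum c0) (image_law mu mphi).
have m2E A : measurable A -> m2 A =
    (\prod_(i < N) fine (mu (phi @^-1` upd A i)))%:E.
  by move=> mA; rewrite prodE EFinM fin_prob//; exact: mpre.
have SE : S = upd (S j) by apply/funext => i; rewrite /upd; case: eqP => // ->.
rewrite SE updE -m1E -m2E//; apply: code_measure_unique => //.
  rewrite m1E preimage_setT setTI (le_lt_trans (probability_le1 _ _)) ?ltry//.
  by apply: measurable_rect; exact: mupd.
move=> s; have ms := measurable_cyl s.
rewrite m1E -updE m2E//; apply: IH; first exact: mupd.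
move=> i ji; rewrite /upd; case: eqP => [_|/eqP ij]; first by exists s.
by apply: tS; rewrite ltn_neqAle eq_sym ij.
Qed.

Let points (b : code) : {ptws nat -> T} := fun i => psi (row i b).

Let measurable_points :
  @measurable_fun _ _ code (borel {ptws nat -> T}) setT points.
Proof.
apply: measurable_borel_ptws => // i.
exact: (measurableT_comp mpsi (measurable_row i)).
Qed.

(** A random code need not encode a point, but decoding each row still gives the law [mu], because
    [phi @^-1] of [psi @^-1] of [A] is [A] by cancellation. *)
Lemma points_product_law : is_product_law nat mu (image_law P measurable_points).
Proof.
move=> s A us mA; rewrite image_lawE.
pose N := (\max_(i <- s) i).+1.
have sN i : i \in s -> (i < N)%N by move=> si; rewrite ltnS leq_bigmax_seq.
pose S i : set code := if i \in s then psi @^-1` (A i) else setT.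
have mS i : measurable (S i).
  by rewrite /S; case: ifP => // _; rewrite -[_ @^-1` _]setTI; exact: mpsi.
rewrite (_ : _ @^-1` _ = rect N S); last first.
  apply/seteqP; split=> b bA i; first by move=> _; rewrite /S; case: ifP => // /bA.
  by move=> si; have := bA i (sN i si); rewrite /S si.
rewrite rect_measurable// -prod_EFin.
have E i : i \in s -> (fine (mu (phi @^-1` S i)))%:E = mu (A i).
  move=> si; rewrite fin_prob; last exact: mpre.
  rewrite /S si; congr (mu _).
  by apply/seteqP; split=> x /=; rewrite psiK.
have -> : (\big[mule/1]_(i <- s) mu (A i) =
    \big[mule/1]_(i <- s) (fine (mu (phi @^-1` S i)))%:E)%E.
  by rewrite big_seq [RHS]big_seq; apply: eq_bigr => i /E.
rewrite -(big_mkord xpredT (fun i => (fine (mu (phi @^-1` S i)))%:E)).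
rewrite (bigID (mem s))/= [X in (_ * X)%E]big1 ?mule1; last first.
  by move=> i /negbTE si; rewrite /S si preimage_setT probability_setT.
rewrite -big_filter; apply: perm_big; apply: uniq_perm => //.
  by rewrite filter_uniq// iota_uniq.
move=> i; rewrite mem_filter mem_index_iota /=.
by case: (boolP (i \in s)) => // /sN.
Qed.

End code_law.

Lemma product_law_nat_exists : exists Q, is_product_law nat mu Q.
Proof.
have [P PE] := exists_code_law.
by eexists; exact: (points_product_law PE).
Qed.

End product_law_nat.

Lemma product_law_exists (R : realType) (I : countType) (T : ptopologicalType)
    (mu : probability (borel T) R) (phi : borel T -> code)
    (psi : code -> borel T) :
  @second_countable T -> coding phi psi -> exists Q, is_product_law I mu Q.
Proof.
move=> cT cod; have [Q QP] := product_law_nat_exists mu cT cod.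
(* Reading an independent sequence at the distinct positions [pickle i] keeps it independent; this
   covers finite and infinite [I]. *)
pose h (x : {ptws nat -> T}) : {ptws I -> T} := fun i => x (pickle i).
have mh : @measurable_fun _ _ (borel {ptws nat -> T}) (borel {ptws I -> T}) setT h.
  apply: continuous_borel_measurable; apply/continuous_ptwsP => i.
  by apply/continuousP => U oU; exact: ptws_eval_open.
exists (image_law Q mh) => s A us mA; rewrite image_lawE.
pose A' n := if unpickle n is Some i then A i else setT.
have -> : h @^-1` [set x | forall i, i \in s -> A i (x i)] =
    [set x | forall n, n \in map pickle s -> A' n (x n)].
  apply/seteqP; split=> x xA.
    by move=> _ /mapP[i si ->]; rewrite /A' pickleK; exact: xA.
  by move=> i si; have := xA _ (map_f pickle si); rewrite /A' pickleK.
rewrite QP.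
- by rewrite big_map; apply: eq_bigr => i _; rewrite /A' pickleK.
- by rewrite map_inj_uniq//; exact: pcan_inj pickleK.
- by move=> n; rewrite /A'; case: unpickle.
Qed.

Lemma product_lawP (R : realType) (I : countType) (T : ptopologicalType)
    (mu : probability (borel T) R) (phi : borel T -> code)
    (psi : code -> borel T) :
  @second_countable T -> coding phi psi ->
  is_product_law I mu (product_law I mu).
Proof.
by move=> cT cod; have [Q QP] := product_law_exists I mu cT cod; exact: getI QP.
Qed.

(** * Uniqueness of product laws *)

Section product_law_unique.
Context (R : realType) (I : countType) (T : ptopologicalType).
Hypothesis cT : @second_countable T.

Definition product_rects : set (set {ptws I -> T}) :=
  [set S | exists (s : seq I) (A : I -> set (borel T)),
     [/\ uniq s, forall i, measurable (A i) &
         S = [set x | forall i, i \in s -> A i (x i)]]].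

Lemma measurable_ptws_eval (i : I) (A : set (borel T)) : measurable A ->
  measurable ([set x | A (x i)] : set (borel {ptws I -> T})).
Proof.
move=> mA.
have me : @measurable_fun _ _ (borel {ptws I -> T}) (borel T) setT
    (fun x => x i).
  apply: continuous_borel_measurable.
  by apply/continuousP => U oU; exact: ptws_eval_open.
by rewrite -[X in measurable X]setTI; exact: (me measurableT).
Qed.

Lemma product_rects_measurable :
  product_rects `<=` (measurable : set (set (borel {ptws I -> T}))).
Proof.
move=> _ [s [A [_ mA ->]]].
rewrite (_ : mkset _ = \bigcap_(i in [set i | i \in s])
  ([set x | A i (x i)] : set (borel {ptws I -> T}))); last by apply/seteqP; split.
apply: fin_bigcap_measurable; first exact: finite_seq.
by move=> i _; exact: measurable_ptws_eval.
Qed.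

Lemma product_rects_setI : setI_closed product_rects.
Proof.
move=> _ _ [s [A [us mA ->]]] [s' [A' [us' mA' ->]]].
exists (undup (s ++ s')), (fun i => (if i \in s then A i else setT) `&`
   (if i \in s' then A' i else setT)); split.
- exact: undup_uniq.
- by move=> i; apply: measurableI; case: ifP.
- apply/seteqP; split=> [x [xA xA'] i _|x xA].
    by split; case: ifP => // ?; [exact: xA|exact: xA'].
  split=> i si; have := xA i; rewrite mem_undup mem_cat si ?orbT => /(_ isT).
    by case.
  by case.
Qed.

Lemma borel_sub_rects :
  (measurable : set (set (borel {ptws I -> T}))) `<=` <<s product_rects >>.
Proof.
have [B bB] := (@second_countableP T).1 cT; have [Bo _] := bB.
apply: smallest_sub; first exact: smallest_sigma_algebra.
move=> U oU.
rewrite (_ : U = \bigcup_(l in [set l | ptws_cylinder B l `<=` U])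
    (ptws_cylinder B l)); last first.
  apply/seteqP; split=> [x Ux|x [l lU lx]]; last exact: lU.
  by have [l [lx lU]] := ptws_cylinder_base bB oU Ux; exists l.
apply: (@bigcup_countType_measurable _ (g_sigma_algebraType product_rects)).
move=> l _; elim: l => [|[i n] l IH].
  rewrite (_ : ptws_cylinder _ _ = setT); last exact/seteqP.
  exact: measurableT.
rewrite ptws_cylinder_cons; apply: measurableI => //.
apply: sub_sigma_algebra; exists [:: i], (fun=> B n); split=> //.
  by move=> _; exact: open_borel.
apply/seteqP; split=> x /=; last by apply; rewrite inE.
by move=> Bx j; rewrite inE => /eqP ->.
Qed.

Lemma product_law_unique (mu : probability (borel T) R)
    (P Q : probability (borel {ptws I -> T}) R) :
  is_product_law I mu P -> is_product_law I mu Q ->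
  forall A, measurable A -> P A = Q A.
Proof.
move=> hP hQ A mA.
apply: (@g_sigma_algebra_measure_unique _ R (borel {ptws I -> T}) _
  product_rects_measurable (fun=> setT)).
- move=> _; exists [::], (fun=> setT); split=> //.
  by apply/seteqP; split.
- by apply/seteqP; split=> // x _; exists 0%N.
- exact: product_rects_setI.
- by move=> _ [s [B [us mB ->]]]; exact: etrans (hP s B us mB) (esym (hQ s B us mB)).
- by move=> _; rewrite /= probability_setT ltry.
- exact: borel_sub_rects.
Qed.

End product_law_unique.

Lemma polish_product_lawP (R : realType) (I : countType)
    (X : polishMetricType R) (mu : probability (borel X) R) :
  is_product_law I mu (product_law I mu).
Proof.
have [phi [psi [cod _]]] := polish_coding_exists X.
by apply: product_lawP cod; exact: polish_second_countable.
Qed.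

(** * The weak law of large numbers *)

Section weak_law_of_large_numbers.
Context d (Om : measurableType d) (R : realType) (P : probability Om R).
Variables (n : nat) (E : 'I_n -> set Om) (p : R).
Hypothesis mE : forall i, measurable (E i).
Hypothesis PE : forall i, P (E i) = p%:E.
Hypothesis PEE : forall i j, i != j -> P (E i `&` E j) = (p * p)%:E.

Let mP : {measure set Om -> \bar R} := P.

Let mPE i : mP (E i) = p%:E. Proof. exact: PE. Qed.

Let mPEE i j : i != j -> mP (E i `&` E j) = (p * p)%:E.
Proof. exact: PEE. Qed.

Let ind0 (A : set Om) x : 0 <= \1_A x :> R.
Proof. by rewrite indicE. Qed.

Let S (x : Om) : R := \sum_(i < n) \1_(E i) x.

Let S0 x : 0 <= S x. Proof. by apply: sumr_ge0 => i _; exact: ind0. Qed.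

Let measurable_S : measurable_fun setT S.
Proof. by apply: measurable_sum => i; exact: measurable_indic. Qed.

Let integral_S : (\int[mP]_x (S x)%:E = (n%:R * p)%:E)%E.
Proof.
rewrite /S; under eq_integral do rewrite -sumEFin.
rewrite ge0_integral_sum//=.
- rewrite (eq_bigr (fun=> p%:E)) => [|i _]; last by rewrite integral_indic// setIT mPE.
  by rewrite sumEFin sumr_const card_ord mulr_natl.
- by move=> i; apply/measurable_EFinP; exact: measurable_indic.
Qed.

Let integral_S2 :
  (\int[mP]_x (S x ^+ 2)%:E = (n%:R * p + n%:R * (n%:R - 1) * p ^+ 2)%:E)%E.
Proof.
have E2 x : (S x ^+ 2)%:E =
    (\sum_(i < n) \sum_(j < n) (\1_(E i `&` E j) x)%:E)%E.
  rewrite expr2 /S mulr_suml -sumEFin; apply: eq_bigr => i _.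
  rewrite mulr_sumr -sumEFin; apply: eq_bigr => j _.
  by rewrite indicI.
under eq_integral do rewrite E2.
rewrite ge0_integral_sum//=; first last.
- by move=> i x _; apply: sume_ge0 => j _; rewrite lee_fin ind0.
- move=> i; apply: emeasurable_sum => j; apply/measurable_EFinP.
  by apply: measurable_indic; exact: measurableI.
rewrite (eq_bigr (fun=> (p + (n%:R - 1) * p ^+ 2)%:E)).
  by rewrite sumEFin sumr_const card_ord; congr EFin; rewrite -mulr_natl; ring.
move=> i _; rewrite ge0_integral_sum//=; first last.
  move=> j; apply/measurable_EFinP.
  by apply: measurable_indic; exact: measurableI.
rewrite (bigD1 i)//= integral_indic//; last exact: measurableI.
rewrite setIid setIT mPE (eq_bigr (fun=> (p ^+ 2)%:E)).
  rewrite sumEFin -EFinD sumr_const; congr (_ + _)%:E.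
  rewrite -[in LHS]mulr_natl; congr (_ * _).
  rewrite (cardC1 i) card_ord.
  have n0 : (0 < n)%N by exact: leq_ltn_trans (ltn_ord i).
  by rewrite -[in RHS](prednK n0) -natr1 addrK.
move=> j ij; rewrite integral_indic//; last exact: measurableI.
by rewrite setIT mPEE// 1?eq_sym.
Qed.

(** Chebyshev's inequality for pairwise independent events, with the variance [n p (1 - p)] bounded
    by [n]. *)
Lemma deviation_bound (c : R) : 0 <= p -> 0 <= c ->
  (P [set x | c <= `|S x - n%:R * p|]%R * (c ^+ 2)%:E <= n%:R%:E)%E.
Proof.
move=> p0 c0; pose V x := (S x - n%:R * p) ^+ 2.
have mV : measurable_fun setT V.
  by apply: measurable_funX; apply: measurable_funB.
have VE : (\int[mP]_x (V x)%:E <= n%:R%:E)%E.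
  (* The square is expanded with all terms on their positive side, which avoids subtraction of
     extended reals; finiteness of the integral of [V] is read off afterwards. *)
  have H : (\int[mP]_x (V x)%:E + (2 * (n%:R * p))%:E * \int[mP]_x (S x)%:E =
     \int[mP]_x (S x ^+ 2)%:E + ((n%:R * p) ^+ 2)%:E)%E.
    rewrite -ge0_integralZl_EFin//; first last.
    - by rewrite !mulr_ge0.
    - exact/measurable_EFinP.
    - by move=> x _; rewrite lee_fin.
    rewrite -[X in (_ + X)%E = _]/(\int[mP]_x ((2 * (n%:R * p)) * S x)%:E)%E.
    rewrite -ge0_integralD//; first last.
    - by apply/measurable_EFinP; apply: measurable_funM.
    - by move=> x _; rewrite lee_fin !mulr_ge0.
    - exact/measurable_EFinP.
    - by move=> x _; rewrite lee_fin sqr_ge0.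
    have -> : ((n%:R * p) ^+ 2)%:E = (\int[mP]_x ((n%:R * p) ^+ 2)%:E)%E.
      by rewrite integral_cst//= probability_setT mule1.
    rewrite -ge0_integralD//.
    - by apply: eq_integral => x _; rewrite -!EFinD /V; congr EFin; ring.
    - by move=> x _; rewrite lee_fin sqr_ge0.
    - by apply/measurable_EFinP; exact: measurable_funX.
    - by move=> x _; rewrite lee_fin sqr_ge0.
  move: H; rewrite integral_S integral_S2 -EFinM -EFinD.
  have : (0 <= \int[mP]_x (V x)%:E)%E.
    by apply: integral_ge0 => x _; rewrite lee_fin sqr_ge0.
  case: (\int[mP]_x _)%E => // v _; rewrite -EFinD => -[H].
  rewrite lee_fin; have np : 0 <= n%:R * p ^+ 2 by rewrite mulr_ge0// sqr_ge0.
  have np1 : n%:R * p <= n%:R.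
    have [->|n0] := eqVneq n 0%N; first by rewrite mul0r.
    rewrite ler_piMr// -lee_fin.
    have i : 'I_n by exists 0%N; rewrite lt0n.
    by rewrite -(PE i) probability_le1.
  by move: H np np1; set a := n%:R; nra.
apply: le_trans VE.
pose D := [set x | c <= `|S x - n%:R * p|].
have mD : measurable D.
  rewrite (_ : D = (fun x => `|S x - n%:R * p|) @^-1` `[c, +oo[%classic).
    rewrite -[_ @^-1` _]setTI; apply: (_ : measurable_fun setT _) => //.
    by apply: measurableT_comp => //; exact: measurable_funB.
  by apply/seteqP; split=> x; rewrite /= in_itv/= andbT.
have <- : (\int[mP]_x ((c ^+ 2)%:E * (\1_D x)%:E) = P D * (c ^+ 2)%:E)%E.
  rewrite ge0_integralZl_EFin//.
  - by rewrite integral_indic// setIT muleC.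
  - by apply/measurable_EFinP; exact: measurable_indic.
  - exact: sqr_ge0.
apply: ge0_le_integral => //.
- by move=> x _; rewrite mule_ge0// lee_fin ?sqr_ge0 ?ind0.
- by apply: emeasurable_funM => //; apply/measurable_EFinP; exact: measurable_indic.
- exact/measurable_EFinP.
move=> x _; rewrite -EFinM lee_fin /V indicE.
case: (boolP (x \in D)) => [/set_mem xD|_]; last by rewrite mulr0 sqr_ge0.
by rewrite mulr1 -[leRHS]real_normK ?num_real// lerXn2r ?nnegrE.
Qed.

End weak_law_of_large_numbers.

(** * Limits of empirical couplings *)

Definition finitely_determined (S : set code) :=
  exists n, forall b b' : code, (forall k, (k < n)%N -> b k = b' k) -> S b -> S b'.

(** Finite additivity of [l] already makes the masses of cylinders consistent, and
    [code_measure_exists] asks for nothing more. Agreement extends to events that read finitely many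
    bits, which are finite unions of cylinders, but not beyond. *)
Lemma content_code_law (R : realType) (Z : Type) (f : Z -> code)
    (l : set Z -> R) :
  (forall A, 0 <= l A) -> l setT = 1 ->
  (forall A B, A `&` B = set0 -> l (A `|` B) = l A + l B) ->
  exists P : probability code R, forall S, measurable S ->
    finitely_determined S -> P S = (l (f @^-1` S))%:E.
Proof.
move=> l_ge0 lT lD.
have l0 : l set0 = 0.
  have := lD set0 set0 (setI0 _); rewrite setU0 => /eqP.
  by rewrite -subr_eq0 opprD addNKr oppr_eq0 => /eqP.
have split S s : l (f @^-1` (cyl s `&` S)) =
    l (f @^-1` (cyl (rcons s false) `&` S)) + l (f @^-1` (cyl (rcons s true) `&` S)).
  rewrite -lD -?preimage_setU -?preimage_setI.
    by rewrite -setIUl -cyl_split.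
  by rewrite setIACA cyl_disj set0I preimage_set0.
have [P PE] := @code_measure_exists R (fun s => l (f @^-1` cyl s))
  (fun s => l_ge0 _) (etrans (congr1 (fun S => l (f @^-1` S)) cyl_nil)
    (etrans (congr1 l (preimage_setT f)) lT))
  (fun s => ltac:(by have := split setT s; rewrite !setIT)).
exists P => S mS [n nS].
rewrite (@cyl_induction R P n (fun s => (l (f @^-1` (cyl s `&` S)))%:E))//.
- by rewrite cyl_nil setTI.
- by move=> s _; rewrite split.
- move=> s sn; have [->|/set0P[b [bs bS]]] := eqVneq (cyl s `&` S) set0.
    by rewrite preimage_set0 l0 measure0.
  rewrite (_ : _ `&` _ = cyl s) ?PE//; apply/setIidPl => b' b's.
  apply: nS bS => k kn.
  by rewrite ((cylP s b').1 b's) ?sn// ((cylP s b).1 bs) ?sn.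
Qed.

Lemma code_law_unique (R : realType) (P Q : probability code R) :
  (forall s, P (cyl s) = Q (cyl s)) -> forall A, measurable A -> P A = Q A.
Proof.
move=> PQ; apply: code_measure_unique => //.
exact: (le_lt_trans (probability_le1 P measurableT) (ltry _)).
Qed.

(** Compactness of the unit interval gives a cluster point, and an ultrafilter converges to its
    cluster points. *)
Lemma bounded_ultra_cvg (R : realType) (U : set_system nat) (u : nat -> R) :
  UltraFilter U -> (forall n, 0 <= u n <= 1) -> cvg (u n @[n --> U]).
Proof.
move=> UU u01.
have [p [_ pcl]] : `[0%R, 1%R]%classic `&` cluster (u n @[n --> U]) !=set0.
  apply: segment_compact; apply: (@filterS _ U _ setT); last exact: filterT.
  by move=> n _; rewrite /= in_itv/= u01.
apply/cvg_ex; exists p => A pA; apply: contrapT => nA.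
have [//|UA] := in_ultra_setVsetC (u @^-1` A) UU.
by have [x [nAx Ax]] := pcl (~` A) A UA pA.
Qed.

Section limit_coupling.
Context (R : realType) (X Y : polishMetricType R).
Context (mu : probability (borel X) R) (nu : probability (borel Y) R).
Variables (phiX : borel X -> code) (psiX : code -> borel X).
Variables (phiY : borel Y -> code) (psiY : code -> borel Y).
Hypotheses (codX : coding phiX psiX) (codY : coding phiY psiY).
Variable e : nat -> set (X * Y) -> R.
Hypothesis e_ge0 : forall m A, 0 <= e m A.
Hypothesis eT : forall m, e m setT = 1.
Hypothesis eD : forall m A B, A `&` B = set0 -> e m (A `|` B) = e m A + e m B.
Hypothesis eX : forall s,
  e m (fst @^-1` (phiX @^-1` cyl s)) @[m --> \oo] --> fine (mu (phiX @^-1` cyl s)).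
Hypothesis eY : forall s,
  e m (snd @^-1` (phiY @^-1` cyl s)) @[m --> \oo] --> fine (nu (phiY @^-1` cyl s)).

Let measurable_pre d d' (S : measurableType d) (T : measurableType d')
  (f : S -> T) A : measurable_fun setT f -> measurable A -> measurable (f @^-1` A).
Proof. by move=> mf mA; rewrite -[_ @^-1` _]setTI; exact: mf. Qed.

Let e_le1 m A : e m A <= 1.
Proof. by rewrite -(eT m) -(setUv A) eD ?setICr// lerDl. Qed.

(* The limit law on bit sequences could charge sequences that encode no pair, as
   mass may escape to infinity; this is excluded because its marginals are
   exactly the laws of [phiX] and [phiY]. *)
Lemma limit_coupling :
  exists (gamma : probability (borel (X * Y)%type) R) (U : set_system nat),
  [/\ coupling mu nu gamma, ProperFilter U, \oo `<=` U &
  forall j k, (0 < gamma ([set x | phiX x j] `*` [set y | phiY y k]))%E ->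
    \forall m \near U, 0 < e m ([set x | phiX x j] `*` [set y | phiY y k])].
Proof.
have [mphiX mpsiX psiXK] := codX; have [mphiY mpsiY psiYK] := codY.
have [U [UU ooU]] := @ultraFilterLemma nat \oo _.
have Ue A : e m A @[m --> U] --> lim (e m A @[m --> U]).
  by apply: (bounded_ultra_cvg UU) => m; rewrite e_ge0 e_le1.
pose l A := lim (e m A @[m --> U]).
have lE A r : e m A @[m --> U] --> r -> l A = r.
  by move=> h; apply: cvg_lim.
pose phi := prod_encode phiX phiY.
have [P PE] : exists P : probability code R, forall S, measurable S ->
    finitely_determined S -> P S = (l (phi @^-1` S))%:E.
  apply: content_code_law.
  - by move=> A; apply: limr_ge; [exact: Ue|exact: nearW].
  - by apply: lE; under eq_fun do rewrite eT; exact: cvg_cst.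
  - move=> A B AB; apply: lE; under eq_fun do rewrite eD//.
    exact: cvgD (Ue A) (Ue B).
have cX : @second_countable X by exact: polish_second_countable.
have cY : @second_countable Y by exact: polish_second_countable.
have [_ mpsi _] := prod_coding cX cY codX codY.
have evensP (S : set code) : measurable S -> P (evens @^-1` S) = mu (phiX @^-1` S).
  move=> mS; rewrite -(image_lawE P measurable_evens) -(image_lawE mu mphiX).
  apply: code_law_unique => // s.
  rewrite -[LHS]/(P (evens @^-1` cyl s)) -[RHS]/(mu (phiX @^-1` cyl s)).
  rewrite PE.
  - rewrite -[RHS]fin_prob; last first.
      by apply: measurable_pre => //; exact: measurable_cyl.
    congr EFin; apply: lE.
    rewrite (_ : phi @^-1` _ = fst @^-1` (phiX @^-1` cyl s)).
      by move=> V Vn; apply: ooU; exact: eX Vn.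
    by apply/seteqP; split=> z; rewrite /= /phi /prod_encode evens_interleave.
  - exact: (measurable_pre measurable_evens (measurable_cyl s)).
  - exists (size s).*2 => b b' bb' /cylP bs; apply/cylP => k ks.
    by rewrite -bs// /evens bb'// ltn_double.
have oddsP (S : set code) : measurable S -> P (odds @^-1` S) = nu (phiY @^-1` S).
  move=> mS; rewrite -(image_lawE P measurable_odds) -(image_lawE nu mphiY).
  apply: code_law_unique => // s.
  rewrite -[LHS]/(P (odds @^-1` cyl s)) -[RHS]/(nu (phiY @^-1` cyl s)).
  rewrite PE.
  - rewrite -[RHS]fin_prob; last first.
      by apply: measurable_pre => //; exact: measurable_cyl.
    congr EFin; apply: lE.
    rewrite (_ : phi @^-1` _ = snd @^-1` (phiY @^-1` cyl s)).
      by move=> V Vn; apply: ooU; exact: eY Vn.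
    by apply/seteqP; split=> z; rewrite /= /phi /prod_encode odds_interleave.
  - exact: (measurable_pre measurable_odds (measurable_cyl s)).
  - exists (size s).*2 => b b' bb' /cylP bs; apply/cylP => k ks.
    by rewrite -bs// /odds bb'// ltn_Sdouble.
have PU : ProperFilter U by exact: ultra_proper.
exists (image_law P mpsi), U; split=> //.
  split=> A mA; rewrite image_lawE.
    rewrite (_ : _ @^-1` _ = evens @^-1` (psiX @^-1` A))// evensP; last first.
      exact: measurable_pre.
    by congr (mu _); apply/seteqP; split=> x /=; rewrite psiXK.
  rewrite (_ : _ @^-1` _ = odds @^-1` (psiY @^-1` A))// oddsP; last first.
    exact: measurable_pre.
  by congr (nu _); apply/seteqP; split=> x /=; rewrite psiYK.
move=> j k; rewrite image_lawE => gt0.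
(* A bit of the decoded point may differ from the same bit of the code. The codes where the former
   is set and the latter is not form a null set, since the marginal is the law of [phiX] and [psiX]
   cancels [phiX]. Outside such codes, the event on decoded points becomes the finitely determined
   event [D], on which the limit frequencies are known. *)
pose NX : set code := [set c | phiX (psiX c) j] `\` [set c | c j].
pose NY : set code := [set c | phiY (psiY c) k] `\` [set c | c k].
have mNX : measurable NX.
  apply: measurableD; last exact: measurable_bit.
  exact: (code_bit_measurable j (measurableT_comp mphiX mpsiX)).
have mNY : measurable NY.
  apply: measurableD; last exact: measurable_bit.
  exact: (code_bit_measurable k (measurableT_comp mphiY mpsiY)).
have NX0 : P (evens @^-1` NX) = 0%E.
  rewrite evensP// (_ : _ @^-1` _ = set0) ?measure0//.
  by apply/seteqP; split=> // x []; rewrite /= psiXK.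
have NY0 : P (odds @^-1` NY) = 0%E.
  rewrite oddsP// (_ : _ @^-1` _ = set0) ?measure0//.
  by apply/seteqP; split=> // x []; rewrite /= psiYK.
pose D : set code := [set b | evens b j /\ odds b k].
have mD : measurable D.
  apply: (@measurableI _ code [set b | evens b j] [set b | odds b k]).
    exact: measurable_bit.
  exact: measurable_bit.
have DP : P D = (l ([set x | phiX x j] `*` [set y | phiY y k]))%:E.
  rewrite PE//.
    congr (l _)%:E; apply/seteqP; split=> z;
    by rewrite /D /= /phi /prod_encode evens_interleave odds_interleave.
  exists (maxn j.*2.+1 k.*2.+2) => b b' bb' [].
  by rewrite /D /evens /odds /= !bb'// leq_max leqnn ?orbT.
have lgt0 : 0 < l ([set x | phiX x j] `*` [set y | phiY y k]).
  rewrite -lte_fin -DP; apply: lt_le_trans gt0 _.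
  have sub : prod_decode psiX psiY @^-1` ([set x | phiX x j] `*` [set y | phiY y k])
      `<=` D `|` (evens @^-1` NX `|` odds @^-1` NY).
    move=> b [/= bj bk]; have [ej|nej] := boolP (evens b j); last first.
      by right; left; split=> //; exact/negP.
    have [ok|nok] := boolP (odds b k); first by left.
    by right; right; split=> //; exact/negP.
  have mX := measurable_pre measurable_evens mNX.
  have mY := measurable_pre measurable_odds mNY.
  apply: (@le_trans _ _ (P (D `|` (evens @^-1` NX `|` odds @^-1` NY)))).
    rewrite le_measure// ?inE//; last by apply: measurableU => //; exact: measurableU.
    apply: measurable_pre => //; apply: measurableI.
      apply: (@measurable_pre _ _ (borel (X * Y)%type) (borel X) fst).
        by apply: continuous_borel_measurable => z; exact: cvg_fst.
      exact: code_bit_measurable.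
    apply: (@measurable_pre _ _ (borel (X * Y)%type) (borel Y) snd).
      by apply: continuous_borel_measurable => z; exact: cvg_snd.
    exact: code_bit_measurable.
  apply: le_trans (measureU2 _ _ _) _ => //; first exact: measurableU.
  rewrite -[leRHS]adde0 leeD2l//; apply: le_trans (measureU2 _ _ _) _ => //.
  rewrite -[leRHS]adde0; apply: leeD; last by rewrite -NY0; exact: lexx.
  by rewrite -NX0; exact: lexx.
exact: (@cvgr_gt _ _ U _ _ _ (Ue _) 0).
Qed.

End limit_coupling.

(** * Wasserstein distances of augmented matrix distributions *)

Lemma real_second_countable (R : realType) : @second_countable R.
Proof.
pose d k : rat * rat := odflt (0, 0) (unpickle k).
apply: (@base_seq_second_countable R
  (fun k => `](ratr (d k).1 : R), ratr (d k).2[%classic)); split.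
  by move=> k; exact: interval_open.
move=> x U oU Ux; have /nbhs_ballP[e /= e0 eU] := open_nbhs_nbhs (conj oU Ux).
have /rat_in_itvoo[a] : x - e < x by rewrite ltrBlDr ltrDl.
rewrite in_itv/= => /andP[ea ax].
have /rat_in_itvoo[b] : x < x + e by rewrite ltrDl.
rewrite in_itv/= => /andP[xb be].
exists (pickle (a, b)); rewrite /d pickleK/= in_itv/= ax xb; split=> // y.
rewrite /= in_itv/= => /andP[ay yb]; apply: eU.
by rewrite /ball/= ltr_norml; apply/andP; split; lra.
Qed.

Lemma augmx_second_countable (R : realType) (B : polishMetricType R)
    (I : countType) : @second_countable (augmx R B I).
Proof.
apply: second_countable_prod; last first.
  exact/second_countable_ptws/polish_second_countable.
apply: (@second_countable_initial _ {ptws (I * I)%type -> R}).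
exact/second_countable_ptws/real_second_countable.
Qed.

Section supp_product.
Context (R : realType) (Z : ptopologicalType).
Hypothesis cZ : @second_countable Z.
Variable mu : probability (borel Z) R.

Lemma supp_product (z z' : Z) :
  supp (mu \x mu)%E (z, z') <-> supp mu z /\ supp mu z'.
Proof.
split=> [s|[sz sz'] U oU Uz].
  split=> U oU Uz.
    have := s (U `*` setT) (openX oU openT) (conj Uz I).
    rewrite product_measure1E//; last exact: open_borel.
    by rewrite [X in (_ * X)%E]probability_setT mule1.
  have := s (setT `*` U) (openX openT oU) (conj I Uz).
  rewrite product_measure1E//; last exact: open_borel.
  by rewrite [X in (X * _)%E]probability_setT mul1e.
have [V [W [oV Vz oW Wz VWU]]] := open_prod_nbhs oU Uz.
have mV := open_borel oV; have mW := open_borel oW.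
apply: lt_le_trans (_ : (mu V * mu W <= _)%E).
  by rewrite mule_gt0//; [exact: sz|exact: sz'].
rewrite -product_measure1E// le_measure// ?inE//; first exact: measurableX.
exact: borel_setX_measurable.
Qed.

End supp_product.

Section augmx_distance.
Context (R : realType) (B : polishMetricType R) (I : Type).
Local Notation rho := (@augmx_dist R B I).

Lemma augmx_dist_leP (u v : augmx R B I) (c : R) :
  (rho u v <= c%:E)%E <->
  (forall i j, `|set_val u.1 (i, j) - set_val v.1 (i, j)| <= 2 * c) /\
  (forall i, mdist (u.2 i) (v.2 i) <= c).
Proof.
rewrite /augmx_dist ge_max -lee_pdivlMl//; split.
  move=> /andP[uv1 uv2]; split=> [i j|i].
    have := le_trans (ereal_sup_ubound (imageP _ (_ : setT (i, j)))) uv1.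
    by rewrite -EFinM lee_fin invrK; apply.
  have := le_trans (ereal_sup_ubound (imageP _ (_ : setT i))) uv2.
  by rewrite lee_fin; apply.
move=> [uv1 uv2]; apply/andP; split.
  apply: ge_ereal_sup => _ [[i j] _ <-].
  by rewrite -EFinM lee_fin invrK.
by apply: ge_ereal_sup => _ [i _ <-]; rewrite lee_fin.
Qed.

(** The witness [i] excludes the empty index set, over which the suprema are [-oo]. *)
Lemma augmx_dist_ge0 (i : I) u v : (0 <= rho u v)%E.
Proof.
rewrite /augmx_dist le_max; apply/orP; right.
apply: (@le_trans _ _ (mdist (u.2 i) (v.2 i))%:E).
  by rewrite lee_fin mdist_ge0.
by apply: ereal_sup_ubound; exists i.
Qed.

Lemma continuous_augmx_entry i j :
  continuous (fun u : augmx R B I => set_val u.1 (i, j) : R).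
Proof.
have := (@continuous_distmxP _ R I (fun u : augmx R B I => u.1)).1.
by move=> H; apply: H => u; exact: cvg_fst.
Qed.

Lemma continuous_augmx_point i : continuous (fun u : augmx R B I => u.2 i).
Proof.
have := (@continuous_ptwsP _ I B (fun u : augmx R B I => u.2)).1.
by move=> H; apply: H => u; exact: cvg_snd.
Qed.

(** Lower semicontinuity: each entry and each point contributes a closed condition, and closed sets
    are stable under arbitrary intersections. *)
Lemma closed_augmx_dist_le (c : R) :
  closed [set z : augmx R B I * augmx R B I | (rho z.1 z.2 <= c%:E)%E].
Proof.
have -> : [set z : augmx R B I * augmx R B I | (rho z.1 z.2 <= c%:E)%E] =
  (\bigcap_(ij in [set: I * I]) [set z : augmx R B I * augmx R B I |
     `|set_val z.1.1 ij - set_val z.2.1 ij| <= 2 * c]) `&`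
  (\bigcap_(i in [set: I]) [set z : augmx R B I * augmx R B I |
     mdist (z.1.2 i) (z.2.2 i) <= c]).
  apply/seteqP; split=> [z /augmx_dist_leP[z1 z2]|z [z1 z2]].
    by split=> [[i j] _|i _]; [exact: z1|exact: z2].
  by apply/augmx_dist_leP; split=> [i j|i]; [exact: (z1 (i, j))|exact: z2].
have cfst : continuous (fst : augmx R B I * augmx R B I -> _).
  by move=> z; exact: cvg_fst.
have csnd : continuous (snd : augmx R B I * augmx R B I -> _).
  by move=> z; exact: cvg_snd.
apply: closedI; apply: closed_bigI => i _.
- apply: (preimage_closed (f := fun z : augmx R B I * augmx R B I =>
      `|set_val z.1.1 i - set_val z.2.1 i|) (D := [set x | x <= 2 * c])); last first.
    exact: closed_le.
  case: i => i j z _.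
  have c1 := continuous_comp_fun cfst (@continuous_augmx_entry i j).
  have c2 := continuous_comp_fun csnd (@continuous_augmx_entry i j).
  have c12 := fun z => continuousB (c1 z) (c2 z).
  exact: (continuous_comp_fun c12 (@norm_continuous _ R^o)).
- apply: (preimage_closed (f := fun z : augmx R B I * augmx R B I =>
      mdist (z.1.2 i) (z.2.2 i)) (D := [set x | x <= c])); last first.
    exact: closed_le.
  move=> z _.
  have c1 := continuous_comp_fun cfst (@continuous_augmx_point i).
  have c2 := continuous_comp_fun csnd (@continuous_augmx_point i).
  exact: (continuous_comp_fun (continuous_pair c1 c2) (@continuous_mdist R B)).
Qed.

End augmx_distance.

(** Union bound: the two exceptional sets together weigh less than [delta], so they cannot cover
    [L]. *)
Lemma coupling_meet (R : realType) (T : ptopologicalType)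
    (D D' : probability (borel T) R) (g : probability (borel (T * T)%type) R)
    (L : set (borel (T * T)%type)) (V V' : set (borel T)) (delta : R) :
  coupling D D' g -> measurable L -> measurable V -> measurable V' ->
  (delta%:E <= g L)%E ->
  (D (~` V) < (delta / 2)%:E)%E -> (D' (~` V') < (delta / 2)%:E)%E ->
  exists z, [/\ L z, V z.1 & V' z.2].
Proof.
move=> [gD gD'] mL mV mV' dL DV DV'; apply: contrapT => nz.
have mfst : @measurable_fun _ _ (borel (T * T)%type) (borel T) setT fst.
  by apply: continuous_borel_measurable => z; exact: cvg_fst.
have msnd : @measurable_fun _ _ (borel (T * T)%type) (borel T) setT snd.
  by apply: continuous_borel_measurable => z; exact: cvg_snd.
have mV1 := measurable_borel_preimage mfst (measurableC mV).
have mV2 := measurable_borel_preimage msnd (measurableC mV').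
have : (g L <= g (fst @^-1` (~` V)) + g (snd @^-1` (~` V')))%E.
  apply: le_trans (measureU2 g mV1 mV2).
  apply: le_measure; rewrite ?inE//; first exact: measurableU.
  move=> z Lz; apply: contrapT => /not_orP[/= /contrapT Vz /contrapT V'z].
  by apply: nz; exists z.
rewrite gD ?gD'; [|exact: measurableC..].
move=> /(le_trans dL); apply/negP; rewrite -ltNge.
by rewrite [X in X%:E]splitr EFinD; exact: lteD.
Qed.

(** * Wasserstein distances for a cost with closed sublevel sets *)

Section wasserstein_bounds.
Context (R : realType) (T : ptopologicalType).
Hypothesis cT : @second_countable T.
Variables (rho : T -> T -> \bar R) (D D' : probability (borel T) R).
Hypothesis rho_ge0 : forall x y, (0 <= rho x y)%E.
Hypothesis closed_rho :
  forall c : R, closed [set z : T * T | (rho z.1 z.2 <= c%:E)%E].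

Let le_set (c : R) : set (borel (T * T)%type) :=
  [set z | (rho z.1 z.2 <= c%:E)%E].

Let measurable_le_set c : measurable (le_set c).
Proof. by apply: closed_borel; exact: closed_rho. Qed.

Let measurable_rho_pow (q : R) :
  @measurable_fun _ _ (borel (T * T)%type) (\bar R) setT
    (fun z => (rho z.1 z.2 `^ q)%E).
Proof.
have mrho : @measurable_fun _ _ (borel (T * T)%type) (\bar R) setT
    (fun z => rho z.1 z.2).
  apply: (measurability _ (ErealGenOInfty.measurableE R)) => // _ [_ [c ->] <-].
  rewrite setTI (_ : _ @^-1` _ = ~` le_set c); first exact: measurableC.
  apply/seteqP; split=> z; rewrite /le_set /= in_itv/= andbT ltNge.
    by move/negP.
  by move/negP.
exact: (measurableT_comp (measurable_poweR q) mrho).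
Qed.

Lemma wasserstein_ge0 (p : \bar R) :
  (1 <= p)%E -> (0 <= wasserstein rho p D D')%E.
Proof.
move=> p1; apply: le_ereal_inf_tmp => _ [g _ <-].
case: p p1 => [q _|_|]//; first exact: poweR_ge0.
(* For [p = +oo] a point of the support is needed, as the supremum over an empty set would be
   [-oo]. *)
have [z gz] : exists z, supp g z.
  apply: contrapT => /forallNP nz.
  have := supp_full g (second_countable_prod cT cT).
  rewrite (_ : ~` _ = setT); last by apply/seteqP; split=> // w _; exact: nz.
  by rewrite [X in X = _]probability_setT => /eqP; rewrite onee_eq0.
apply: (le_trans (rho_ge0 z.1 z.2)).
by apply: ereal_sup_ubound; exists z.
Qed.

Lemma wasserstein_le (p : \bar R) (g : probability (borel (T * T)%type) R) (c : R) :
  (1 <= p)%E -> 0 <= c -> coupling D D' g -> g (~` le_set c) = 0%E ->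
  (wasserstein rho p D D' <= c%:E)%E.
Proof.
move=> p1 c0 gD g0; apply: le_trans (ereal_inf_lbound _) _; first by exists g.
case: p p1 => [q| |]//; last first.
  move=> _; apply: ge_ereal_sup => _ [z sz <-].
  exact: (supp_subset (@closed_rho c) g0 sz).
rewrite lee_fin => q1.
have q0 : 0 < q by exact: lt_le_trans q1.
have H : (\int[g]_z (rho z.1 z.2 `^ q) <= (c `^ q)%:E)%E.
  have <- : (\int[g]_z (c `^ q)%:E = (c `^ q)%:E)%E.
    by rewrite integral_cst//= probability_setT mule1.
  apply: ae_ge0_le_integral => //.
  - by move=> z _; exact: poweR_ge0.
  - by move=> z _; rewrite lee_fin powR_ge0.
  exists (~` le_set c); split=> //; first exact: measurableC.
  move=> z /= zc zl; apply: zc => _; rewrite -poweR_EFin.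
  apply: gt0_ler_poweR (ltW q0) _ _ _ _ zl; rewrite in_itv/= leey andbT ?lee_fin//.
apply: (@le_trans _ _ ((c `^ q)%:E `^ q^-1)%E).
  apply: gt0_ler_poweR => //; rewrite ?invr_ge0 ?(ltW q0)// in_itv/= leey andbT.
    by apply: integral_ge0 => z _; exact: poweR_ge0.
  by rewrite lee_fin powR_ge0.
by rewrite poweR_EFin -powRrM divff ?gt_eqF// powRr1.
Qed.

(* Markov's inequality; the bound does not depend on the size of [I]. *)
Lemma wasserstein_lt (p : \bar R) (c c' : R) :
  (1 <= p)%E -> 0 < c -> c < c' -> (wasserstein rho p D D' < c%:E)%E ->
  exists2 g, coupling D D' g & ((1 - c / c')%:E <= g (le_set c'))%E.
Proof.
move=> p1 c0 cc' /ereal_inf_lt[_ [g gD <-] gc]; exists g => //.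
have c'0 : 0 < c' by exact: lt_trans cc'.
rewrite -[le_set c']setCK probability_setC; last exact: measurableC.
rewrite EFinB; apply: leeB => //.
case: p p1 gc => [q| |]//; last first.
  move=> _ gc; rewrite (_ : g _ = 0%E) ?lee_fin ?divr_ge0 ?ltW//.
  have := supp_full g (second_countable_prod cT cT); apply: subset_measure0 => //.
  - exact: measurableC.
  - by apply: open_borel; exact/closed_openC/supp_closed.
  move=> z zc sz; apply: zc; rewrite /le_set /=.
  apply: le_trans (ltW (lt_trans gc _)); last by rewrite lte_fin.
  by apply: ereal_sup_ubound; exists z.
rewrite lee_fin => q1 gc.
have q0 : 0 < q by exact: lt_le_trans q1.
have H : (g (~` le_set c') * (c' `^ q)%:E <= \int[g]_z (rho z.1 z.2 `^ q))%E.
  have <- : (\int[g]_z ((c' `^ q)%:E * (\1_(~` le_set c') z)%:E) =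
      g (~` le_set c') * (c' `^ q)%:E)%E.
    rewrite ge0_integralZl_EFin//.
    - by rewrite integral_indic ?setIT 1?muleC//; exact: measurableC.
    - by apply/measurable_EFinP; apply: measurable_indic; exact: measurableC.
    - by rewrite powR_ge0.
  apply: ge0_le_integral => //.
  - by move=> z _; rewrite mule_ge0// lee_fin ?powR_ge0 ?indicE.
  - apply: emeasurable_funM => //; apply/measurable_EFinP.
    by apply: measurable_indic; exact: measurableC.
  move=> z _; rewrite indicE; have [zc|_] := boolP (z \in _); last first.
    by rewrite mule0 poweR_ge0.
  rewrite mule1 -poweR_EFin; apply: gt0_ler_poweR (ltW q0) _ _ _ _ _.
  - by rewrite in_itv/= leey andbT lee_fin ltW.
  - by rewrite in_itv/= leey andbT.
  - by move/set_mem: zc => /negP; rewrite -ltNge => /ltW.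
have J0 : (0 <= \int[g]_z (rho z.1 z.2 `^ q))%E.
  by apply: integral_ge0 => z _; exact: poweR_ge0.
have Jc : (\int[g]_z (rho z.1 z.2 `^ q) <= (c `^ q)%:E)%E.
  rewrite leNgt; apply/negP => /ltW cJ; move: gc; apply/negP; rewrite -leNgt.
  have -> : c%:E = ((c `^ q)%:E `^ q^-1)%E.
    by rewrite poweR_EFin -powRrM divff ?gt_eqF// powRr1// ltW.
  apply: gt0_ler_poweR cJ; rewrite ?invr_ge0 ?(ltW q0)// in_itv/= leey andbT//.
  by rewrite lee_fin powR_ge0.
have := le_trans H Jc.
rewrite -fin_prob; last exact: measurableC.
set a := fine _; rewrite -EFinM !lee_fin => ac.
have c'q : 0 < c' `^ q by rewrite powR_gt0.
(* Markov's inequality for the power [q] gives [(c / c')] to the [q], which is at most [c / c']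
   because [c / c' <= 1 <= q]; one bound serves all exponents. *)
apply: (@le_trans _ _ ((c / c') `^ q)).
  rewrite -(ler_pM2r c'q) (le_trans ac)// -powRM ?divr_ge0 ?(ltW c0) ?(ltW c'0)//.
  by rewrite divfK// lt0r_neq0.
have cc : 0 < c / c' <= 1 by rewrite divr_gt0//= ler_pdivrMr// mul1r ltW.
by rewrite (le_trans (ger_powR cc q1))// powRr1// ltW//; case/andP: cc.
Qed.

Lemma wasserstein_lt_meet (p : \bar R) (c c' : R) (V V' : set (borel T)) :
  (1 <= p)%E -> 0 < c -> c < c' -> (wasserstein rho p D D' < c%:E)%E ->
  measurable V -> measurable V' ->
  (D (~` V) < ((1 - c / c') / 2)%:E)%E ->
  (D' (~` V') < ((1 - c / c') / 2)%:E)%E ->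
  exists u v, [/\ V u, V' v & (rho u v <= c'%:E)%E].
Proof.
move=> p1 c0 cc' Wc mV mV' DV DV'.
have [g gDD' gc] := wasserstein_lt p1 c0 cc' Wc.
have [[u v] [uv Vu V'v]] :=
  coupling_meet gDD' (measurable_le_set c') mV mV' gc DV DV'.
by exists u, v.
Qed.

Lemma wasserstein_image_le (S : ptopologicalType) (Q : probability (borel S) R)
    (f f' : S -> T) (N : set (borel S)) (M p : \bar R) :
  (1 <= p)%E -> continuous f -> continuous f' ->
  (forall A : set (borel T), measurable A -> Q (f @^-1` A) = D A) ->
  (forall A : set (borel T), measurable A -> Q (f' @^-1` A) = D' A) ->
  measurable N -> Q N = 0%E -> (forall z, ~ N z -> (rho (f z) (f' z) <= M)%E) ->
  (wasserstein rho p D D' <= M)%E.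
Proof.
move=> p1 cf cf' fD fD' mN N0 NM.
(* A point outside the null set [N] shows that [M] is nonnegative, which excludes [-oo]. *)
have [z Nz] : exists z, ~ N z.
  apply: contrapT => /forallNP nz; have := probability_setT Q.
  rewrite (_ : setT = N) ?N0; first by move/eqP; rewrite eq_sym onee_eq0.
  by apply/seteqP; split=> // z _; apply: contrapT; exact: nz.
have := le_trans (rho_ge0 _ _) (NM _ Nz).
case: M NM => [c| |]// NM; last by move=> _; rewrite leey.
rewrite lee_fin => c0.
have mff' : @measurable_fun _ _ (borel S) (borel (T * T)%type) setT
    (fun z => (f z, f' z)).
  by apply: continuous_borel_measurable; exact: continuous_pair.
apply: (@wasserstein_le p (image_law Q mff') c p1 c0).
  by split=> A mA; [exact: (fD A mA)|exact: (fD' A mA)].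
apply: (subset_measure0 (mu := Q)) N0 => //.
  by apply: measurable_borel_preimage => //; exact: measurableC.
by move=> w nle; apply: contrapT => /NM.
Qed.

End wasserstein_bounds.

(** * The upper bound *)

Lemma bigcup_countType_null d (T : measurableType d) (R : realType)
    (mu : {measure set T -> \bar R}) (I : countType) (F : I -> set T) :
  (forall i, measurable (F i)) -> (forall i, mu (F i) = 0%E) ->
  mu (\bigcup_i F i) = 0%E.
Proof.
move=> mF F0; apply/negligibleP; first exact: bigcup_countType_measurable.
pose F' n := if unpickle n is Some i then F i else set0.
have : mu.-negligible (\bigcup_n F' n).
  apply: negligible_bigcup => n; rewrite /F'; case: unpickle => [i|].
    by apply/negligibleP; [exact: mF|exact: F0].
  exact: negligible_set0.
apply: negligibleS => x [i _ Fx].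
by exists (pickle i) => //; rewrite /F' pickleK.
Qed.

Lemma product_law_image (R : realType) (I : countType) (S T : ptopologicalType)
    (h : S -> T) (mu : probability (borel S) R) (nu : probability (borel T) R)
    (Q : probability (borel {ptws I -> S}) R)
    (mh : @measurable_fun _ _ (borel S) (borel T) setT h)
    (mH : @measurable_fun _ _ (borel {ptws I -> S}) (borel {ptws I -> T}) setT
      (fun z i => h (z i))) :
  is_product_law I mu Q ->
  (forall A : set (borel T), measurable A -> mu (h @^-1` A) = nu A) ->
  is_product_law I nu (image_law Q mH).
Proof.
move=> QP hmu s A us mA.
have mhA i : measurable (h @^-1` A i : set (borel S)).
  exact: measurable_borel_preimage.
transitivity (\big[mule/1%E]_(i <- s) mu (h @^-1` A i)).
  exact: (QP s (fun i => h @^-1` A i)).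
by apply: eq_bigr => i _; exact: hmu.
Qed.

Lemma continuous_ptws_map (I : Type) (S T : topologicalType) (h : S -> T) :
  continuous h ->
  continuous (fun (z : {ptws I -> S}) => (fun i => h (z i)) : {ptws I -> T}).
Proof.
move=> ch; apply/continuous_ptwsP => i.
have ce : continuous (fun z : {ptws I -> S} => z i).
  by apply/continuousP => U oU; exact: ptws_eval_open.
exact: (continuous_comp_fun ce ch).
Qed.

Lemma augmx_distributionE (R : realType) (B : polishMetricType R)
    (X : mm_field B) (I : countType) A :
  augmx_distribution X I A =
  product_law I (mm_meas X) (@mm_augmx R B X I @^-1` A).
Proof. by []. Qed.

(** The coordinatewise image of [Q] under [h] and the law picked by [product_law] are both product
    laws of [mm_meas X], hence equal. With [h] a projection, this identifies the marginals of
    sampled pairs. *)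
Lemma augmx_distribution_image (R : realType) (B : polishMetricType R)
    (X : mm_field B) (I : countType) (S : ptopologicalType) (h : S -> X)
    (mu : probability (borel S) R) (Q : probability (borel {ptws I -> S}) R)
    (A : set (borel (augmx R B I))) :
  continuous h -> is_product_law I mu Q ->
  (forall C : set (borel X), measurable C -> mu (h @^-1` C) = mm_meas X C) ->
  measurable A ->
  Q [set z | A (mm_augmx (fun i => h (z i)))] = augmx_distribution X I A.
Proof.
move=> ch QP hmu mA.
have mh := continuous_borel_measurable ch.
have mH := continuous_borel_measurable (@continuous_ptws_map I _ _ _ ch).
rewrite augmx_distributionE.
have mF := continuous_borel_measurable (@continuous_mm_augmx R B X I).
have mFA := measurable_borel_preimage mF mA.
have P1 := product_law_image mh mH QP hmu.
have P2 := @polish_product_lawP R I X (mm_meas X).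
by rewrite -(product_law_unique (@polish_second_countable R X) P1 P2 mFA).
Qed.

Definition augmx_wasserstein (R : realType) (B : polishMetricType R)
    (X Y : mm_field B) (p : \bar R) (I : countType) : \bar R :=
  wasserstein (@augmx_dist R B I) p
    (augmx_distribution X I) (augmx_distribution Y I).

Section upper_bound.
Context (R : realType) (B : polishMetricType R) (X Y : mm_field B).
Variable mu : probability (borel (X * Y)%type) R.
Hypothesis muXY : coupling (mm_meas X) (mm_meas Y) mu.
Context (I : countType) (i0 : I).

Let cX := @polish_second_countable R X.
Let cY := @polish_second_countable R Y.
Let cXY := second_countable_prod cX cY.

Let Q := product_law I mu.

Let QP : is_product_law I mu Q.
Proof.
have [phi [psi [cod _]]] := polish_coding_exists X.
have [phi' [psi' [cod' _]]] := polish_coding_exists Y.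
exact: (@product_lawP R I _ mu _ _ cXY (prod_coding cX cY cod cod')).
Qed.

Let cfst : continuous (fst : X * Y -> X).
Proof. by move=> z; exact: cvg_fst. Qed.

Let csnd : continuous (snd : X * Y -> Y).
Proof. by move=> z; exact: cvg_snd. Qed.

Let outliers : set (borel {ptws I -> (X * Y)%type}) :=
  \bigcup_i [set z | ~ supp mu (z i)].

Let measurable_supp : measurable (~` supp mu : set (borel (X * Y)%type)).
Proof. by apply: open_borel; exact/closed_openC/supp_closed. Qed.

Let measurable_outliers : measurable outliers.
Proof.
apply: bigcup_countType_measurable => i _.
exact: (measurable_ptws_eval i measurable_supp).
Qed.

Let outliers0 : Q outliers = 0%E.
Proof.
apply: (bigcup_countType_null (mu := Q)) => i.
  exact: (measurable_ptws_eval i measurable_supp).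
have := @QP [:: i] (fun=> ~` supp mu) isT (fun=> measurable_supp).
rewrite big_seq1 supp_full// => <-; congr (Q _).
apply/seteqP; split=> z /=; last by apply; rewrite inE.
by move=> zi j; rewrite inE => /eqP ->.
Qed.

(** The support of [mu \x mu] is the square of the support of [mu], so the suprema on the left run
    over subsets of those on the right. *)
Lemma augmx_dist_le_supp (z : {ptws I -> (X * Y)%type}) : ~ outliers z ->
  (augmx_dist (mm_augmx (fun i => (z i).1 : X)) (mm_augmx (fun i => (z i).2 : Y))
   <= maxe (2^-1%:E * ereal_sup
        [set `|mdist z.1.1 z.2.1 - mdist z.1.2 z.2.2|%:E
          | z in supp (mu \x mu)%E : set ((X * Y) * (X * Y))])%E
      (ereal_sup [set (mdist (mm_proj z.1) (mm_proj z.2))%:E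
          | z in supp mu : set (X * Y)]))%E.
Proof.
move=> nz; have sz i : supp mu (z i).
  by apply: contrapT => nzi; apply: nz; exists i.
rewrite ge_max !le_max; apply/andP; split; apply/orP; [left|right].
  apply: lee_wpmul2l => //; apply: le_ereal_sup => _ [[i j] _ <-].
  by exists (z i, z j) => //; exact/supp_product.
by apply: le_ereal_sup => _ [i _ <-]; exists (z i).
Qed.

Lemma wasserstein_le_coupling (p : \bar R) : (1 <= p)%E ->
  (augmx_wasserstein X Y p I <= maxe (2^-1%:E * ereal_sup
        [set `|mdist z.1.1 z.2.1 - mdist z.1.2 z.2.2|%:E
          | z in supp (mu \x mu)%E : set ((X * Y) * (X * Y))])%E
      (ereal_sup [set (mdist (mm_proj z.1) (mm_proj z.2))%:E
          | z in supp mu : set (X * Y)]))%E.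
Proof.
move=> p1; rewrite /augmx_wasserstein.
apply: (wasserstein_image_le (@augmx_dist_ge0 R B I i0)
  (@closed_augmx_dist_le R B I) p1
  (continuous_comp_fun (continuous_ptws_map cfst) (@continuous_mm_augmx R B X I))
  (continuous_comp_fun (continuous_ptws_map csnd) (@continuous_mm_augmx R B Y I))
  _ _ measurable_outliers outliers0 augmx_dist_le_supp).
- by move=> A mA; exact: (augmx_distribution_image cfst QP muXY.1 mA).
- by move=> A mA; exact: (augmx_distribution_image csnd QP muXY.2 mA).
Qed.

End upper_bound.

(** * The lower bound *)

(** Chebyshev at deviation [n * eta] costs [n / (n * eta) ^ 2], that is [1 / (n * eta ^ 2)], for
    each of the [m] test sets. Only the coordinates reached by [iota] are sampled, so [I] may be
    infinite. *)
Lemma empirical_deviation (R : realType) (T : ptopologicalType)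
    (mu : probability (borel T) R) (n m : nat) (I : countType) (iota : 'I_n -> I)
    (Q : probability (borel {ptws I -> T}) R) (A : nat -> set (borel T))
    (eta : R) :
  injective iota -> is_product_law I mu Q -> (0 < n)%N -> 0 < eta ->
  (forall k, measurable (A k)) ->
  exists2 G : set (borel {ptws I -> T}),
    measurable G /\ (Q (~` G) <= (m%:R / (n%:R * eta ^+ 2))%:E)%E &
    forall x, G x -> forall k, (k < m)%N ->
      `|(\sum_(i < n) \1_(A k) (x (iota i))) / n%:R - fine (mu (A k))| < eta.
Proof.
move=> iotaI QP n0 eta0 mA; have nR : 0 < n%:R :> R by rewrite ltr0n.
pose S k (x : {ptws I -> T}) : R := \sum_(i < n) \1_(A k) (x (iota i)).
pose bad k : set (borel {ptws I -> T}) :=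
  [set x | n%:R * eta <= `|S k x - n%:R * fine (mu (A k))|].
have mE k i : measurable ([set x | A k (x (iota i))] : set (borel {ptws I -> T})).
  exact: measurable_ptws_eval.
have SE k x : S k x = \sum_(i < n) \1_[set x : borel {ptws I -> T} | A k (x (iota i))] x.
  by apply: eq_bigr => i _; rewrite !indicE; congr (_%:R);
    apply/idP/idP => /set_mem ?; exact/mem_set.
have mbad k : measurable (bad k).
  rewrite (_ : bad k = (fun x => `|S k x - n%:R * fine (mu (A k))|) @^-1`
      `[n%:R * eta, +oo[%classic); last first.
    by apply/seteqP; split=> x; rewrite /= in_itv/= andbT.
  rewrite -[_ @^-1` _]setTI; apply: (_ : measurable_fun setT _) => //.
  apply: measurableT_comp => //; apply: measurable_funB => //.
  rewrite (funext (SE k)).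
  by apply: measurable_sum => i; exact: measurable_indic.
have bad_le k : (Q (bad k) <= (n%:R * eta ^+ 2)^-1%:E)%E.
  have PE i : Q [set x | A k (x (iota i))] = (fine (mu (A k)))%:E.
    rewrite fin_prob//; have := QP [:: iota i] (fun=> A k) isT (fun=> mA k).
    rewrite big_seq1 => <-; congr (Q _).
    apply/seteqP; split=> x /=; last by apply; rewrite inE.
    by move=> xi j; rewrite inE => /eqP ->.
  have PEE i j : i != j -> Q ([set x | A k (x (iota i))] `&` [set x | A k (x (iota j))]) =
      (fine (mu (A k)) * fine (mu (A k)))%:E.
    move=> ij; rewrite EFinM !fin_prob//.
    have uij : uniq [:: iota i; iota j] by rewrite /= inE (inj_eq iotaI) ij.
    have := QP [:: iota i; iota j] (fun=> A k) uij (fun=> mA k).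
    rewrite big_cons big_seq1 => <-; congr (Q _).
    apply/seteqP; split=> x /=; last first.
      by move=> H; split; apply: H; rewrite !inE eqxx ?orbT.
    by move=> [xi xj] l; rewrite !inE => /orP[] /eqP ->.
  have := deviation_bound (mE k) PE PEE (fine_ge0 (measure_ge0 mu (A k)))
    (ltW (mulr_gt0 nR eta0)).
  rewrite (_ : mkset _ = bad k); last first.
    by apply/seteqP; split=> x; rewrite /bad /= SE.
  rewrite -fin_prob// -EFinM !lee_fin -ler_pdivlMr ?exprn_gt0 ?mulr_gt0//.
  move=> /le_trans; apply; rewrite le_eqVlt; apply/orP; left; apply/eqP.
  by field; rewrite !gt_eqF.
exists (~` \bigcup_(k < m) bad k).
  split; first by apply: measurableC; exact: bigcup_measurable.
  rewrite setCK; elim: m => [|m IH].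
    by rewrite II0 bigcup_set0 measure0 mul0r.
  rewrite IIS bigcup_setU bigcup_set1.
  apply: le_trans (measureU2 _ _ _) _ => //; first exact: bigcup_measurable.
  rewrite -natr1 mulrDl EFinD mul1r; apply: leeD; [exact: IH|exact: bad_le].
move=> x Gx k km; rewrite ltNge; apply/negP => dev; apply: Gx; exists k => //=.
rewrite -(ler_pM2l nR) in dev; apply: le_trans dev _.
by rewrite -[X in X * `|_|]gtr0_norm// -normrM mulrBr mulrCA divff ?gt_eqF// mulr1.
Qed.

Section sample_neighbourhood.
Context (R : realType) (B : polishMetricType R) (X : mm_field B) (n : nat)
  (I : countType) (iota : 'I_n -> I).
Variables (G : set {ptws I -> X}) (eta : R).

Definition sample_nbhd : set (augmx R B I) :=
  [set u | exists2 x, G x &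
    (forall i j, `|set_val u.1 (iota i, iota j) -
                   mdist (x (iota i)) (x (iota j))| < eta) /\
    (forall i, mdist (u.2 (iota i)) (mm_proj (x (iota i))) < eta)].

(** Finitely many strict inequalities between continuous functions of [u], for a fixed good sample
    [x]. *)
Lemma sample_nbhd_open : open sample_nbhd.
Proof.
rewrite openE => u [x Gx [u1 u2]]; rewrite /interior.
have n1 i j : \forall v \near u,
    `|set_val v.1 (iota i, iota j) - mdist (x (iota i)) (x (iota j))| < eta.
  have := @continuous_augmx_entry R B I (iota i) (iota j) u.
  have e0 : 0 < eta -
      `|set_val u.1 (iota i, iota j) - mdist (x (iota i)) (x (iota j))|.
    by rewrite subr_gt0.
  move=> /cvgrPdist_lt/(_ _ e0); apply: filterS => v uv.
  have := ler_distD (set_val u.1 (iota i, iota j)) (set_val v.1 (iota i, iota j))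
    (mdist (x (iota i)) (x (iota j))).
  by rewrite [X in _ <= X + _]distrC; lra.
have n2 i : \forall v \near u, mdist (v.2 (iota i)) (mm_proj (x (iota i))) < eta.
  have := @continuous_augmx_point R B I (iota i) u.
  have e0 : 0 < eta - mdist (u.2 (iota i)) (mm_proj (x (iota i))) by rewrite subr_gt0.
  move=> /metricType_numDomainType.cvgrPdist_lt/(_ _ e0); apply: filterS => v uv.
  have := metric_triangle (v.2 (iota i)) (u.2 (iota i)) (mm_proj (x (iota i))).
  by rewrite [X in _ <= X + _]metric_sym; lra.
have N1 : \forall v \near u, forall i j,
    `|set_val v.1 (iota i, iota j) - mdist (x (iota i)) (x (iota j))| < eta.
  exact: (@filter_forall _ 'I_n _ _ _ (fun i => @filter_forall _ 'I_n _ _ _ (n1 i))).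
have N2 : \forall v \near u, forall i, mdist (v.2 (iota i)) (mm_proj (x (iota i))) < eta.
  exact: (@filter_forall _ 'I_n _ _ _ n2).
by apply: filterS2 N1 N2 => v v1 v2; exists x.
Qed.

Lemma sample_nbhd_sub : 0 < eta ->
  G `<=` @mm_augmx R B X I @^-1` sample_nbhd.
Proof.
move=> eta0 x Gx; exists x => //; split=> [i j|i] /=.
  by rewrite subrr normr0.
by rewrite mdistxx.
Qed.

End sample_neighbourhood.

Lemma norm_sub_le_of_close (R : realType) (a b d d' c e : R) :
  `|a - d| < e -> `|b - d'| < e -> `|a - b| <= 2 * c ->
  `|d - d'| <= 2 * c + 2 * e.
Proof.
rewrite !ltr_norml !ler_norml => /andP[? ?] /andP[? ?] /andP[? ?].
by apply/andP; split; lra.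
Qed.

Lemma mdist_le_of_close (R : realType) (Z : metricType R) (u v a b : Z)
    (c e : R) :
  mdist u a < e -> mdist v b < e -> mdist u v <= c -> mdist a b <= c + 2 * e.
Proof.
have := metric_triangle a u b; have := metric_triangle u v b.
by rewrite (metric_sym a u); lra.
Qed.

Lemma mdist_sub_le_of_close (R : realType) (Z : metricType R) (a b a' b' : Z)
    (e : R) :
  mdist a a' < e -> mdist b b' < e -> `|mdist a b - mdist a' b'| < 2 * e.
Proof.
have := metric_triangle a a' b; have := metric_triangle a' b' b.
have := metric_triangle a' a b'; have := metric_triangle a b b'.
rewrite (metric_sym a' a) (metric_sym b' b) => ? ? ? ? ? ?.
by rewrite ltr_norml; apply/andP; split; lra.
Qed.

Section lower_bound.
Context (R : realType) (B : polishMetricType R) (X Y : mm_field B).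

Variables (q : \bar R) (q1 : (1 <= q)%E).

(** What survives of a coupling of matrix laws: a finite paired sample in which [I] and the exponent
    no longer appear. Here [m] counts the test sets and [eta] is the tolerance, so that one such
    record can be chosen for every [m]. *)
Record close_samples (m : nat) (c eta : R) (A : nat -> set (borel X))
    (A' : nat -> set (borel Y)) := CloseSamples {
  samples_size : nat ;
  samples_fst : 'I_samples_size -> X ;
  samples_snd : 'I_samples_size -> Y ;
  samples_size_gt0 : (0 < samples_size)%N ;
  samples_freq_fst : forall k, (k < m)%N ->
    `|(\sum_(i < samples_size) \1_(A k) (samples_fst i)) / samples_size%:R -
      fine (mm_meas X (A k))| < eta ;
  samples_freq_snd : forall k, (k < m)%N ->
    `|(\sum_(i < samples_size) \1_(A' k) (samples_snd i)) / samples_size%:R -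
      fine (mm_meas Y (A' k))| < eta ;
  samples_dist : forall i j,
    `|mdist (samples_fst i) (samples_fst j) - mdist (samples_snd i) (samples_snd j)|
    <= 2 * c + 2 * eta ;
  samples_proj : forall i,
    mdist (mm_proj (samples_fst i)) (mm_proj (samples_snd i)) <= c + 2 * eta }.

(** The event of distance at most [c'] has mass at least [1 - c / c']; each family of bad samples is
    given less than half of it, so some pair of matrices is good on both sides. *)
Lemma coupled_samples (I : countType) (i0 : I) (n m : nat) (iota : 'I_n -> I)
    (c c' eta : R) (A : nat -> set (borel X)) (A' : nat -> set (borel Y)) :
  injective iota -> 0 < c -> c < c' ->
  (augmx_wasserstein X Y q I < c%:E)%E ->
  (0 < n)%N -> 0 < eta ->
  m%:R / (n%:R * eta ^+ 2) < (1 - c / c') / 2 ->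
  (forall k, measurable (A k)) -> (forall k, measurable (A' k)) ->
  exists _ : close_samples m c' eta A A', True.
Proof.
move=> iotaI c0 cc' Wc n0 eta0 small mA mA'.
have [G [mG GP] Gdev] := empirical_deviation m iotaI
  (@polish_product_lawP R I X (mm_meas X)) n0 eta0 mA.
have [G' [mG' GP'] Gdev'] := empirical_deviation m iotaI
  (@polish_product_lawP R I Y (mm_meas Y)) n0 eta0 mA'.
have nbhd_small (Z : mm_field B) (H : set (borel {ptws I -> Z})) :
    measurable H ->
    (product_law I (mm_meas Z) (~` H) <= (m%:R / (n%:R * eta ^+ 2))%:E)%E ->
    (augmx_distribution Z I (~` sample_nbhd iota H eta) < ((1 - c / c') / 2)%:E)%E.
  move=> mH HP; rewrite augmx_distributionE.
  apply: le_lt_trans (_ : _ <= (m%:R / (n%:R * eta ^+ 2))%:E)%E _; last first.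
    by rewrite lte_fin.
  apply: le_trans HP; apply: le_measure; rewrite ?inE.
  - have mF := continuous_borel_measurable (@continuous_mm_augmx R B Z I).
    apply: (measurable_borel_preimage mF); apply: measurableC.
    by apply: open_borel; exact: sample_nbhd_open.
  - exact: measurableC.
  - move=> x nx Hx; apply: nx; exact: (sample_nbhd_sub iota eta0 Hx).
have mV := open_borel (@sample_nbhd_open R B X n I iota G eta).
have mV' := open_borel (@sample_nbhd_open R B Y n I iota G' eta).
have [u [v [[x Gx [ux1 ux2]] [y Gy [vy1 vy2]] /augmx_dist_leP[uv1 uv2]]]] :=
  wasserstein_lt_meet (@augmx_second_countable R B I) (@augmx_dist_ge0 R B I i0)
    (@closed_augmx_dist_le R B I) q1 c0 cc' Wc mV mV'
    (nbhd_small _ _ mG GP) (nbhd_small _ _ mG' GP').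
(* The matrices [u] and [v] need not come from samples; passing to the nearby samples [x] and [y]
   costs [eta] on each side. *)
have dist_le i j : `|mdist (x (iota i)) (x (iota j)) -
    mdist (y (iota i)) (y (iota j))| <= 2 * c' + 2 * eta.
  exact: norm_sub_le_of_close (ux1 i j) (vy1 i j) (uv1 (iota i) (iota j)).
have proj_le i : mdist (mm_proj (x (iota i))) (mm_proj (y (iota i))) <=
    c' + 2 * eta.
  exact: mdist_le_of_close (ux2 i) (vy2 i) (uv2 (iota i)).
by exists (@CloseSamples m c' eta A A' n (x \o iota) (y \o iota) n0
  (Gdev x Gx) (Gdev' y Gy) dist_le proj_le).
Qed.

Section limit_of_samples.
Variables (n : nat -> nat) (x : forall m, 'I_(n m) -> X) (y : forall m, 'I_(n m) -> Y).
Arguments x : clear implicits.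
Arguments y : clear implicits.

Let e m (S : set (X * Y)) : R :=
  (\sum_(i < n m) \1_S (x m i, y m i)) / (n m)%:R.

Lemma empirical_ge0 m S : 0 <= e m S.
Proof. by rewrite divr_ge0// sumr_ge0// => i _; rewrite indicE. Qed.

Lemma empiricalT m : (0 < n m)%N -> e m setT = 1.
Proof.
move=> n0; rewrite /e (eq_bigr (fun=> 1)) => [|i _]; last by rewrite indicT.
by rewrite sumr_const card_ord divff// pnatr_eq0 -lt0n.
Qed.

Lemma empiricalU m S S' : S `&` S' = set0 -> e m (S `|` S') = e m S + e m S'.
Proof.
move=> SS'; rewrite /e -mulrDl -big_split/=; congr (_ / _).
apply: eq_bigr => i _; rewrite !indicE in_setU -natrD; congr (_%:R).
case: (boolP (_ \in S)) => [/set_mem iS|//].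
case: (boolP (_ \in S')) => [/set_mem iS'|//].
by have : (S `&` S') (x m i, y m i) by []; rewrite SS'.
Qed.

Lemma empirical_gt0 m S : 0 < e m S -> exists i : 'I_(n m), S (x m i, y m i).
Proof.
move=> eS; apply: contrapT => /forallNP nS.
suff e0 : e m S = 0 by rewrite e0 ltxx in eS.
rewrite /e big1 ?mul0r// => i _; rewrite indicE memNset//; exact: nS.
Qed.

Hypothesis n_gt0 : forall m, (0 < n m)%N.
Variables (c : R) (eta : nat -> R).
Hypothesis eta_cvg : eta m @[m --> \oo] --> 0.
Hypothesis dist_le : forall m i j,
  `|mdist (x m i) (x m j) - mdist (y m i) (y m j)| <= 2 * c + 2 * eta m.
Hypothesis proj_le : forall m i,
  mdist (mm_proj (x m i)) (mm_proj (y m i)) <= c + 2 * eta m.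
Variables (phi : borel X -> code) (psi : code -> borel X).
Variables (phi' : borel Y -> code) (psi' : code -> borel Y).
Hypotheses (cod : coding phi psi) (cod' : coding phi' psi').
Hypothesis bX : base_seq (fun j => [set z : X | phi z j]).
Hypothesis bY : base_seq (fun j => [set z : Y | phi' z j]).
Hypothesis freqX : forall s,
  (\sum_(i < n m) \1_(phi @^-1` cyl s) (x m i)) / (n m)%:R @[m --> \oo] -->
  fine (mm_meas X (phi @^-1` cyl s)).
Hypothesis freqY : forall s,
  (\sum_(i < n m) \1_(phi' @^-1` cyl s) (y m i)) / (n m)%:R @[m --> \oo] -->
  fine (mm_meas Y (phi' @^-1` cyl s)).

(** A basic rectangle around a point of the support of [gamma] has positive mass, hence positive
    empirical frequency along [U], so it contains a sampled pair. Points of the support are thus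
    limits of sampled pairs, and the bounds on samples pass to them. *)
Lemma dGW_infty_le_of_samples : (dGW_infty X Y <= c%:E)%E.
Proof.
have eX s : e m (fst @^-1` (phi @^-1` cyl s)) @[m --> \oo] -->
    fine (mm_meas X (phi @^-1` cyl s)) by exact: freqX.
have eY s : e m (snd @^-1` (phi' @^-1` cyl s)) @[m --> \oo] -->
    fine (mm_meas Y (phi' @^-1` cyl s)) by exact: freqY.
have [gamma [U [gXY PU ooU gU]]] := limit_coupling cod cod'
  empirical_ge0 (fun m => empiricalT (n_gt0 m)) empiricalU eX eY.
have near_sample (z : X * Y) (eps : R) : supp gamma z -> 0 < eps ->
    \forall m \near U, exists i, mdist z.1 (x m i) < eps /\
                                 mdist z.2 (y m i) < eps.
  move=> sz eps0.
  have z11 : mdist z.1 z.1 < eps by rewrite mdistxx.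
  have z22 : mdist z.2 z.2 < eps by rewrite mdistxx.
  have [j [Bj Bje]] := bX.2 z.1 _ (mball_open z.1 eps) z11.
  have [k [Bk Bke]] := bY.2 z.2 _ (mball_open z.2 eps) z22.
  have oB := openX (bX.1 j) (bY.1 k).
  have /gU : (0 < gamma ([set x | phi x j] `*` [set y | phi' y k]))%E.
    by apply: sz oB _; split.
  apply: filterS => m /empirical_gt0[i [/= xi yi]]; exists i.
  by split; [exact: Bje|exact: Bke].
have near_eta (eps : R) : 0 < eps -> \forall m \near U, eta m < eps.
  move=> eps0; apply: ooU; have /cvgrPdist_lt/(_ _ eps0) := eta_cvg.
  apply: filterS => m; rewrite sub0r normrN; apply: le_lt_trans.
  exact: ler_norm.
apply: le_trans (ereal_inf_lbound _) _; first by exists gamma.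
rewrite ge_max; apply/andP; split; last first.
  apply: ge_ereal_sup => _ [z sz <-]; rewrite lee_fin.
  (* Two projections move by less than [eps / 4] each and [2 * eta m] is below [eps / 2]. *)
  apply/ler_addgt0Pr => eps eps0; have eps4 : 0 < eps / 4 by rewrite divr_gt0.
  have [m [[i [xi yi]] em]] :=
    filter_ex (filterI (near_sample z _ sz eps4) (near_eta _ eps4)).
  have := proj_le i.
  have := metric_triangle (mm_proj z.1) (mm_proj (x m i)) (mm_proj z.2).
  have := metric_triangle (mm_proj (x m i)) (mm_proj (y m i)) (mm_proj z.2).
  have := mm_proj_lip z.1 (x m i); have := mm_proj_lip (y m i) z.2.
  by rewrite [X in _ <= X -> _]metric_sym; lra.
rewrite -lee_pdivlMl//; apply: ge_ereal_sup => _ [[z z'] szz' <-] /=.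
have [sz sz'] := (supp_product
  (second_countable_prod (@polish_second_countable R X) (@polish_second_countable R Y))
  gamma z z').1 szz'.
rewrite -EFinM lee_fin invrK; apply/ler_addgt0Pr => eps eps0.
(* Each of the two distances has two endpoints to move, and [2 * eta m] counts for two more
   sixths. *)
have eps6 : 0 < eps / 6 by rewrite divr_gt0.
have [m [[[i [xi yi]] [i' [xi' yi']]] em]] := filter_ex (filterI
  (filterI (near_sample z _ sz eps6) (near_sample z' _ sz' eps6)) (near_eta _ eps6)).
have := mdist_sub_le_of_close xi xi'; have := mdist_sub_le_of_close yi yi'.
have := dist_le i i'; clear -em.
move: (mdist _ _) (mdist _ _) (mdist _ _) (mdist _ _) => a b d d'.
rewrite !ltr_norml !ler_norml => /andP[? ?] /andP[? ?] /andP[? ?].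
by apply/andP; split; lra.
Qed.

End limit_of_samples.

(** The index set may change with n, so that one statement serves both limits: [nat] contains
    samples of every size, while the sets ['I_n] are used along a subsequence of sizes. *)
Lemma dGW_infty_le (c c' : R) : 0 < c -> c < c' ->
  (forall N, exists2 n, (N < n)%N & exists (I : countType) (i0 : I)
     (iota : 'I_n -> I), injective iota /\
     (augmx_wasserstein X Y q I < c%:E)%E) ->
  (dGW_infty X Y <= c'%:E)%E.
Proof.
move=> c0 cc' H.
have [phi [psi [cod bX]]] := polish_coding_exists X.
have [phi' [psi' [cod' bY]]] := polish_coding_exists Y.
have [mphi _ _] := cod; have [mphi' _ _] := cod'.
(* All words are enumerated; the sample chosen at stage m is controlled on the first m of them, so
   each word is controlled from some stage on. *)
pose word k : seq bool := odflt [::] (unpickle k).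
pose A k : set (borel X) := phi @^-1` cyl (word k).
pose A' k : set (borel Y) := phi' @^-1` cyl (word k).
have mA k : measurable (A k).
  by rewrite /A -[_ @^-1` _]setTI; apply: mphi => //; exact: measurable_cyl.
have mA' k : measurable (A' k).
  by rewrite /A' -[_ @^-1` _]setTI; apply: mphi' => //; exact: measurable_cyl.
pose eta m : R := m.+1%:R^-1.
have eta0 m : 0 < eta m by rewrite invr_gt0.
have delta0 : 0 < (1 - c / c') / 2.
  by rewrite divr_gt0// subr_gt0 ltr_pdivrMr ?mul1r// (lt_trans c0).
have step m : exists _ : close_samples m c' (eta m) A A', True.
  (* The sample size beyond which the deviation bound [m / (n * eta ^ 2)] falls below
     [(1 - c / c') / 2]. *)
  pose r : R := m%:R / (eta m ^+ 2 * ((1 - c / c') / 2)).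
  have [n rn [I [i0 [iota [iotaI Wc]]]]] := H (Num.truncn r).
  have n0 : (0 < n)%N by exact: leq_ltn_trans rn.
  have nR : 0 < n%:R :> R by rewrite ltr0n.
  have small : m%:R / (n%:R * eta m ^+ 2) < (1 - c / c') / 2.
    rewrite ltr_pdivrMr; last exact: mulr_gt0 nR (exprn_gt0 2 (eta0 m)).
    have : r < n%:R by rewrite (lt_le_trans (truncnS_gt r))// ler_nat.
    rewrite /r ltr_pdivrMr; last exact: mulr_gt0 (exprn_gt0 2 (eta0 m)) delta0.
    by rewrite mulrA [_ / 2 * (n%:R * _)]mulrC.
  exact: (coupled_samples i0 iotaI c0 cc' Wc n0 (eta0 m) small mA mA').
pose s m := projT1 (cid (step m)).
have eta_cvg : eta m @[m --> \oo] --> 0 by exact: cvg_harmonic.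
have freq_cvg (u : nat -> R) (l : R) k :
    (forall m, (k < m)%N -> `|u m - l| < eta m) -> u m @[m --> \oo] --> l.
  move=> ul; apply/cvgrPdist_lt => eps eps0.
  have /cvgrPdist_lt/(_ _ eps0) := eta_cvg.
  have : \forall m \near \oo, (k < m)%N by exists k.+1.
  apply: filterS2 => m km; rewrite sub0r normrN gtr0_norm//.
  by apply: lt_trans; rewrite distrC; exact: ul.
have wordK t : word (pickle t) = t by rewrite /word pickleK.
apply: (dGW_infty_le_of_samples (fun m => samples_size_gt0 (s m)) eta_cvg
  (fun m => @samples_dist _ _ _ _ _ (s m)) (fun m => @samples_proj _ _ _ _ _ (s m))
  cod cod' bX bY) => t.
- rewrite -(wordK t).
  exact: (freq_cvg _ _ (pickle t) (fun m => @samples_freq_fst _ _ _ _ _ (s m) _)).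
- rewrite -(wordK t).
  exact: (freq_cvg _ _ (pickle t) (fun m => @samples_freq_snd _ _ _ _ _ (s m) _)).
Qed.

End lower_bound.

(** * Equality for infinite matrices and convergence for finite blocks *)

Section wasserstein_dGW.
Context (R : realType) (B : polishMetricType R) (X Y : mm_field B).
Variables (p : \bar R) (p1 : (1 <= p)%E).

Local Notation W := (augmx_wasserstein X Y p).

Lemma wasserstein_le_dGW (I : countType) (i0 : I) : (W I <= dGW_infty X Y)%E.
Proof.
apply: le_ereal_inf_tmp => _ [mu muXY <-].
exact: wasserstein_le_coupling.
Qed.

Lemma wasserstein_augmx_ge0 (I : countType) (i0 : I) : (0 <= W I)%E.
Proof.
apply: wasserstein_ge0 => //; first exact: augmx_second_countable.
exact: (@augmx_dist_ge0 R B I i0).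
Qed.

Lemma dGW_le_wasserstein : (dGW_infty X Y <= W nat)%E.
Proof.
have W0 := wasserstein_augmx_ge0 0%N.
case WE : (W nat) W0 => [w| |]// w0; last by rewrite leey.
rewrite lee_fin in w0.
apply/lee_addgt0Pr => e e0; rewrite -EFinD.
(* The middle value [w + e / 2] is positive even for [w = 0], and leaves room below [w + e]. *)
apply: (@dGW_infty_le _ _ _ _ _ p1 (w + e / 2)); [lra|lra|] => N.
exists N.+1 => //; exists nat, 0%N, (val : 'I_N.+1 -> nat); split.
  exact: val_inj.
by rewrite WE lte_fin; lra.
Qed.

Lemma wasserstein_nat_dGW : W nat = dGW_infty X Y.
Proof.
by apply/eqP; rewrite eq_le dGW_le_wasserstein wasserstein_le_dGW//; exact: 0%N.
Qed.

(** By contraposition: distances below [c] for arbitrarily large n already force [dGW_infty X Y] to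
    be at most [c']. *)
Lemma wasserstein_ord_ge (c c' : R) : 0 < c -> c < c' ->
  (c'%:E < dGW_infty X Y)%E -> \forall n \near \oo, (c%:E <= W 'I_n)%E.
Proof.
move=> c0 cc' c'd; apply: contrapT => nW.
move: c'd; apply/negP; rewrite -leNgt.
apply: (dGW_infty_le p1 c0 cc') => N; apply: contrapT => H; apply: nW.
exists N.+1 => // n /= Nn; rewrite leNgt; apply/negP => Wc; apply: H.
have n0 : (0 < n)%N by exact: leq_trans Nn.
by exists n => //; exists 'I_n, (Ordinal n0), id; split.
Qed.

Lemma wasserstein_ord_cvg : W 'I_n @[n --> \oo] --> dGW_infty X Y.
Proof.
have W_le : \forall n \near \oo, (0 <= W 'I_n)%E /\ (W 'I_n <= dGW_infty X Y)%E.
  (* The case n = 0 is left out, as the suprema over ['I_0] are [-oo]. *)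
  exists 1%N => // n /= n0; split.
    exact: (wasserstein_augmx_ge0 (Ordinal n0)).
  exact: (wasserstein_le_dGW (Ordinal n0)).
have d0 : (0 <= dGW_infty X Y)%E.
  by have [n [/le_trans]] := filter_ex W_le; apply.
case dE : (dGW_infty X Y) d0 => [d| |]// d0; last first.
  apply/cvgeyPge => A; have := @wasserstein_ord_ge (Num.max A 1) (Num.max A 1 + 1).
  rewrite dE ltry lt_max ltr01 orbT ltrDl ltr01 => /(_ isT isT isT).
  by apply: filterS => n; apply: le_trans; rewrite lee_fin le_max lexx.
rewrite lee_fin in d0; apply/fine_cvgP; split.
  apply: filterS W_le => n; rewrite dE => -[W0 Wd].
  by rewrite ge0_fin_numE// (le_lt_trans Wd)// ltry.
apply/cvgrPdist_lt => e e0.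
have W_gt : \forall n \near \oo, ((d - e)%:E < W 'I_n)%E.
  (* The lower bound applies only to positive levels; below 0, nonnegativity of the distances is
     enough. *)
  have [de|de] := ltP (d - e) 0.
    apply: filterS W_le => n [W0 _]; apply: lt_le_trans W0.
    by rewrite lte_fin.
  have := @wasserstein_ord_ge (d - e / 2) (d - e / 4).
  rewrite dE lte_fin => H.
  have : \forall n \near \oo, ((d - e / 2)%:E <= W 'I_n)%E by apply: H; lra.
  by apply: filterS => n; apply: lt_le_trans; rewrite lte_fin; lra.
apply: filterS2 W_le W_gt => n; rewrite dE /=.
case: (W 'I_n) => [w| |] []//; rewrite !lee_fin lte_fin => w0 wd wde.
by rewrite ltr_norml/=; apply/andP; split; lra.
Qed.

End wasserstein_dGW.

Theorem theorem6p5 (R : realType) (B : polishMetricType R) (X Y : mm_field B)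
    (bX : mm_bounded X) (bY : mm_bounded Y) (p : \bar R) (p1 : (1 <= p)%E) :
  wasserstein (@augmx_dist R B 'I_n) p
      (augmx_distribution X 'I_n) (augmx_distribution Y 'I_n)
    @[n --> \oo] -->
  wasserstein (@augmx_dist R B nat) p
      (augmx_distribution X nat) (augmx_distribution Y nat) /\
  wasserstein (@augmx_dist R B nat) p
      (augmx_distribution X nat) (augmx_distribution Y nat) =
  dGW_infty X Y.
Proof.
have W_nat := wasserstein_nat_dGW X Y p1.
split; last exact: W_nat.
by rewrite -/(augmx_wasserstein X Y p nat) W_nat; exact: wasserstein_ord_cvg.
Qed.
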